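(* Let $K$ be a commutative field and $\mathcal{F}:\mathfrak{C}\to\mathfrak{D}$ a $K$-linear pseudofunctor between $K$-linear 2-categories. Then the deformation complex $X^{\bullet}(\mathcal{F})$ coincides with the cochain complex obtained from the trivially enhanced 2-cosemisimplicial object $(\mathcal{C}^{\bullet}(\mathcal{F}),O,\tau)$ in $\mathbf{Cat}_K$ when one takes as reference objects in $\mathcal{C}^n(\mathcal{F})$, $n\ge 1$, those defined inductively by $X_n:=O^n_n(X_{n-1})$ and $X'_n:=O^{n-1}_n(X'_{n-1})$, with $X_0=X'_0=\star$ the unique object of $\mathcal{C}^0(\mathcal{F})$. (All constructions are spelled out in the context.)
   Context: 2-categories are strict and small. Vertical composition is $\cdot$; horizontal composition and composition of 1-morphisms is $\circ$. A $K$-linear 2-category has $K$-linear hom-categories and $K$-bilinear composition functors $c_{X,Y,Z}$; $c_{X_0,\ldots,X_n}$ denotes iterated composition (identity if $n=1$). A $K$-linear pseudofunctor $\mathcal{F}$ consists of an object map, $K$-linear functors $\mathcal{F}_{X,Y}:\mathfrak{C}(X,Y)\to\mathfrak{D}(\mathcal{F}(X),\mathcal{F}(Y))$, natural isomorphisms $\widehat{\mathcal{F}}_{X,Y,Z}$ with components $\widehat{\mathcal{F}}(f,g):\mathcal{F}(g)\circ\mathcal{F}(f)\Rightarrow\mathcal{F}(g\circ f)$ natural in $(f,g)$, and 2-isomorphisms $\mathcal{F}_0(X):\mathcal{F}(\mathrm{id}_X)\Rightarrow\mathrm{id}_{\mathcal{F}(X)}$, such that $\widehat{\mathcal{F}}(g\circ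 f,l)\cdot(1_{\mathcal{F}(l)}\circ\widehat{\mathcal{F}}(f,g))=\widehat{\mathcal{F}}(f,l\circ g)\cdot(\widehat{\mathcal{F}}(g,l)\circ 1_{\mathcal{F}(f)})$, $\widehat{\mathcal{F}}(\mathrm{id}_X,f)=1_{\mathcal{F}(f)}\circ\mathcal{F}_0(X)$ and $\widehat{\mathcal{F}}(f,\mathrm{id}_Y)=\mathcal{F}_0(Y)\circ 1_{\mathcal{F}(f)}$. Iterates. For positive integers with $i_1+\cdots+i_r=n$, $s_j=i_1+\cdots+i_j$, $s_0=0$, the $n$-iterate $\mathcal{F}^{(i_1,\ldots,i_r)}$ is the family, indexed by $(X_0,\ldots,X_n)\in|\mathfrak{C}|^{n+1}$, of $K$-multilinear functors $\mathfrak{C}(X_0,X_1)\times\cdots\times\mathfrak{C}(X_{n-1},X_n)\to\mathfrak{D}(\mathcal{F}(X_0),\mathcal{F}(X_n))$ (equivalently, $K$-linear functors on the Deligne product $\odot$) obtained by composing within each block with $c^{\mathfrak{C}}_{X_{s_{j-1}},\ldots,X_{s_j}}$, applying $\mathcal{F}_{X_{s_{j-1}},X_{s_j}}$, and composing the results in $\mathfrak{D}$. In particular $\mathcal{F}^{(1,\ldots,1)}(f_0,\ldots,f_{n-1})=\mathcal{F}(f_{n-1})\circ\cdots\circ\mathcal{F}(f_0)$ and $\mathcal{F}^{(n)}(f_0,\ldots,f_{n-1})=\mathcal{F}(f_{n-1}\circ\cdots\circ f_0)$. An indexed natural transformation $\psi:H\Rightarrow H'$ of $n$-iterates is an arbitrary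 family of natural transformations $\psi_{X_0,\ldots,X_n}:H_{X_0,\ldots,X_n}\Rightarrow H'_{X_0,\ldots,X_n}$, composed vertically componentwise; they form $K$-modules. Deformation complex. $X^n(\mathcal{F})=\prod_{(X_0,\ldots,X_n)}\mathrm{Nat}(\mathcal{F}^{(1,\ldots,1)}_{X_0,\ldots,X_n},\mathcal{F}^{(n)}_{X_0,\ldots,X_n})$ for $n\ge1$ and $X^n(\mathcal{F})=0$ otherwise. For $n\ge 2$, $\delta:X^{n-1}(\mathcal{F})\to X^n(\mathcal{F})$ is $$(\delta\varphi)(f_0,\ldots,f_{n-1})=\lceil\varphi(f_1,\ldots,f_{n-1})\circ 1_{\mathcal{F}(f_0)}\rceil+\sum_{i=1}^{n-1}(-1)^i\lceil\varphi(f_0,\ldots,f_i\circ f_{i-1},\ldots,f_{n-1})\rceil+(-1)^n\lceil 1_{\mathcal{F}(f_{n-1})}\circ\varphi(f_0,\ldots,f_{n-2})\rceil,$$ for $f_i:X_i\to X_{i+1}$, where the padding operators $\lceil-\rceil$ compose (vertically) with the canonical 2-isomorphisms built from $\widehat{\mathcal{F}}$ so that the result goes from $\mathcal{F}(f_{n-1})\circ\cdots\circ\mathcal{F}(f_0)$ to $\mathcal{F}(f_{n-1}\circ\cdots\circ f_0)$: respectively $\widehat{\mathcal{F}}(f_0,f_{n-1}\circ\cdots\circ f_1)\cdot(-)$ for the first term; $(-)\cdot(1_{\mathcal{F}(f_{n-1})\circ\cdots\circ\mathcal{F}(f_{i+1})}\circ\widehat{\mathcal{F}}(f_{i-1},f_i)\circ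 1_{\mathcal{F}(f_{i-2})\circ\cdots\circ\mathcal{F}(f_0)})$ for the $i$-th; $\widehat{\mathcal{F}}(f_{n-2}\circ\cdots\circ f_0,f_{n-1})\cdot(-)$ for the last. 2-cosemisimplicial object of $\mathcal{F}$. $\mathcal{C}^0(\mathcal{F})=\mathbf{1}$ has only the object $\star$ (regarded as an object of $\mathbf{Cat}_K$, the 2-category of small $K$-linear categories, $K$-linear functors and natural transformations); for $n\ge1$, $\mathcal{C}^n(\mathcal{F})$ has $n$-iterates as objects and indexed natural transformations as morphisms. The coface functors $O^i_n:\mathcal{C}^{n-1}(\mathcal{F})\to\mathcal{C}^n(\mathcal{F})$ are: $O^0_1=O^1_1$ sends $\star$ to $\mathcal{F}^{(1)}$; for $n\ge2$, $O^0_n(H)_{X_0,\ldots,X_n}=c^{\mathfrak{D}}\circ(\mathcal{F}_{X_0,X_1}\times H_{X_1,\ldots,X_n})$, $O^i_n(H)_{X_0,\ldots,X_n}=H_{X_0,\ldots,\widehat{X_i},\ldots,X_n}\circ(\mathrm{id}\times\cdots\times c^{\mathfrak{C}}_{X_{i-1},X_i,X_{i+1}}\times\cdots\times\mathrm{id})$ for $1\le i\le n-1$, $O^n_n(H)_{X_0,\ldots,X_n}=c^{\mathfrak{D}}\circ(H_{X_0,\ldots,X_{n-1}}\times\mathcal{F}_{X_{n-1},X_n})$, and on morphisms $\psi$ by the same formulas with $H$ replaced by $\psi$ and the other functors by their identity transformations. The coherers $\tau^n_{ij}:O^j_{n+1}\circ O^i_n\Rightarrow O^i_{n+1}\circ O^{j-1}_n$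 ($0\le i<j\le n+1$) are identities except: $\tau^1_{0,1}(\star)=\widehat{\mathcal{F}}^{-1}$, $\tau^1_{1,2}(\star)=\widehat{\mathcal{F}}$, and for $n\ge2$, $\tau^n_{0,1}(H)_{X_0,\ldots,X_{n+1}}=\mathbf{1}_{c^{\mathfrak{D}}}\circ(\widehat{\mathcal{F}}^{-1}_{X_0,X_1,X_2}\times\mathbf{1}_{H_{X_2,\ldots,X_{n+1}}})$, $\tau^n_{n,n+1}(H)_{X_0,\ldots,X_{n+1}}=\mathbf{1}_{c^{\mathfrak{D}}}\circ(\mathbf{1}_{H_{X_0,\ldots,X_{n-1}}}\times\widehat{\mathcal{F}}_{X_{n-1},X_n,X_{n+1}})$. The trivial enhancement is $\phi=\mathrm{id}:O^1_1\Rightarrow O^0_1$. Associated cochain complex. Any two composites $O_n^{i_n}\circ\cdots\circ O_1^{i_1}$ and $O_n^{j_n}\circ\cdots\circ O_1^{j_1}$ ($0\le i_q,j_q\le q$) are related by a unique canonical natural isomorphism $\tau^{\phi}_{(i_1,\ldots,i_n),(j_1,\ldots,j_n)}$ that is a vertical composite, along a sequence of tuples, of whiskered coherers $1\circ\tau^m_{ij}\circ 1$, whiskerings $1\circ\phi$, and their inverses. The reference objects in the claim correspond to the tuples $(1,2,\ldots,n)$ for $X_n$ and $(0,1,\ldots,n-1)$ for $X'_n$. The complex has $M^n=\mathrm{Hom}_{\mathcal{C}^n(\mathcal{F})}(X_n,X'_n)$, $n\ge1$ (and $0$ otherwise), with coboundary $M^{n-1}\to M^n$, $n\geq 2$, $\delta(\varphi)=\sum_{i=0}^n(-1)^i\alpha_{i,n}\cdot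 O^i_n(\varphi)\cdot\beta_{i,n}$, where $\alpha_{i,n}=(\tau^{\phi}_{(0,1,\ldots,n-2,i),(0,1,\ldots,n-1)})_{\star}:O^i_n(X'_{n-1})\to X'_n$ and $\beta_{i,n}=(\tau^{\phi}_{(1,\ldots,n),(1,\ldots,n-1,i)})_{\star}:X_n\to O^i_n(X_{n-1})$. *)

(* Defs.v *)
From HB Require Import structures.
From mathcomp Require Import all_boot all_algebra.
From mathcomp Require Import boolp.

Set Implicit Arguments.
Unset Strict Implicit.
Unset Printing Implicit Defensive.
Import GRing.Theory.
Local Open Scope ring_scope.

Reserved Notation "v \vo u" (at level 40, left associativity).
Reserved Notation "v \ho u" (at level 40, left associativity).
Reserved Notation "g \co f" (at level 40, left associativity).

Record lincat (K : fieldType) := LinCat {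
  ob :> Type;
  hom : ob -> ob -> lmodType K;
  idm : forall x, hom x x;
  vcomp : forall x y z, hom y z -> hom x y -> hom x z;
  vcomp1l : forall x y (u : hom x y), vcomp (idm y) u = u;
  vcomp1r : forall x y (u : hom x y), vcomp u (idm x) = u;
  vcompA : forall x y z t (w : hom z t) (v : hom y z) (u : hom x y),
    vcomp w (vcomp v u) = vcomp (vcomp w v) u;
  vcomp_linl : forall x y z (u : hom x y),
    linear (fun v : hom y z => vcomp v u);
  vcomp_linr : forall x y z (v : hom y z),
    linear (fun u : hom x y => vcomp v u) }.

Arguments hom {K l} _ _.
Arguments idm {K l} x.
Arguments vcomp {K l x y z} _ _.
Notation "v \vo u" := (vcomp v u).

(* A morphism together with its source and target.  Equations between
   morphisms whose sources and targets agree only propositionally are stated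
   as equations between these packages. *)
Definition arr (K : fieldType) (A : lincat K) (x y : A) (u : hom x y) :
    {x : A & {y : A & hom x y}} :=
  existT _ x (existT _ y u).

(* The identity of x, seen as a morphism x -> y when x = y. *)
Definition idto (K : fieldType) (A : lincat K) (x y : A) (e : x = y) :
    hom x y :=
  match e in _ = z return hom x z with erefl => idm x end.

Record isom (K : fieldType) (A : lincat K) (x y : A) := Isom {
  fwd :> hom x y;
  bwd : hom y x;
  bwdK : bwd \vo fwd = idm x;
  fwdK : fwd \vo bwd = idm y }.

Record linfunctor (K : fieldType) (A B : lincat K) := LinFunctor {
  fob :> A -> B;
  fmor : forall x y, hom x y -> hom (fob x) (fob y);
  fmor1 : forall x, fmor (idm x) = idm (fob x);
  fmorM : forall x y z (v : hom y z) (u : hom x y),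
    fmor (v \vo u) = fmor v \vo fmor u;
  fmor_lin : forall x y, linear (@fmor x y) }.

Arguments fmor {K A B} l {x y} _.

Record natiso (K : fieldType) (A B : lincat K) (P Q : linfunctor A B) :=
  NatIso {
    ni :> forall x, isom (P x) (Q x);
    ni_nat : forall x y (u : hom x y),
      ni y \vo fmor P u = fmor Q u \vo ni x }.

Section LinCatTheory.
Variable K : fieldType.
Implicit Types A B : lincat K.

Lemma vcomp0l A (x y z : A) (u : hom x y) : (0 : hom y z) \vo u = 0.
Proof.
have := vcomp_linl u (-1) (0 : hom y z) 0.
by rewrite scaler0 addr0 scaleN1r addNr.
Qed.

Lemma vcomp0r A (x y z : A) (v : hom y z) : v \vo (0 : hom x y) = 0.
Proof.
have := vcomp_linr v (-1) (0 : hom x y) 0.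
by rewrite scaler0 addr0 scaleN1r addNr.
Qed.

Lemma vcompDl A (x y z : A) (v w : hom y z) (u : hom x y) :
  (v + w) \vo u = v \vo u + w \vo u.
Proof. by have := vcomp_linl u 1 v w; rewrite !scale1r. Qed.

Lemma vcompDr A (x y z : A) (v : hom y z) (u w : hom x y) :
  v \vo (u + w) = v \vo u + v \vo w.
Proof. by have := vcomp_linr v 1 u w; rewrite !scale1r. Qed.

Lemma vcompZl A (x y z : A) a (v : hom y z) (u : hom x y) :
  (a *: v) \vo u = a *: (v \vo u).
Proof. by have := vcomp_linl u a v 0; rewrite !addr0 vcomp0l addr0. Qed.

Lemma vcompZr A (x y z : A) a (v : hom y z) (u : hom x y) :
  v \vo (a *: u) = a *: (v \vo u).
Proof. by have := vcomp_linr v a u 0; rewrite !addr0 vcomp0r addr0. Qed.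

Lemma vcomp_suml A (x y z : A) (I : Type) (r : seq I) (p : pred I)
    (v : I -> hom y z) (u : hom x y) :
  (\sum_(i <- r | p i) v i) \vo u = \sum_(i <- r | p i) (v i \vo u).
Proof.
by apply: (big_morph (fun v => v \vo u)) => [v1 v2|];
  rewrite ?vcompDl ?vcomp0l.
Qed.

Lemma vcomp_sumr A (x y z : A) (I : Type) (r : seq I) (p : pred I)
    (v : hom y z) (u : I -> hom x y) :
  v \vo (\sum_(i <- r | p i) u i) = \sum_(i <- r | p i) (v \vo u i).
Proof.
by apply: (big_morph (fun u => v \vo u)) => [v1 v2|];
  rewrite ?vcompDr ?vcomp0r.
Qed.

Lemma fmor0 A B (P : linfunctor A B) (x y : A) :
  fmor P (0 : hom x y) = 0.
Proof.
have := fmor_lin P (-1) (0 : hom x y) 0.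
by rewrite scaler0 addr0 scaleN1r addNr.
Qed.

Lemma fmorZ A B (P : linfunctor A B) (x y : A) a (u : hom x y) :
  fmor P (a *: u) = a *: fmor P u.
Proof. by have := fmor_lin P a u 0; rewrite !addr0 fmor0 addr0. Qed.

Lemma arr_idto A (x y x' y' : A) (u : hom x y) (v : hom x' y') :
  arr u = arr v -> forall (e : x = x') (e' : y = y'),
  idto e' \vo u = v \vo idto e.
Proof.
move=> E.
pose P (z : {x : A & {y : A & hom x y}}) :=
  forall (e : x = projT1 z) (e' : y = projT1 (projT2 z)),
    idto e' \vo u = projT2 (projT2 z) \vo idto e.
suff: P (arr v) by [].
rewrite -E => /= e e'.
by rewrite (Prop_irrelevance e erefl) (Prop_irrelevance e' erefl) /=
  vcomp1l vcomp1r.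
Qed.

Lemma arr_inj A (x y : A) (u v : hom x y) : arr u = arr v -> u = v.
Proof.
by move=> E; have := arr_idto E erefl erefl; rewrite /= vcomp1l vcomp1r.
Qed.

Lemma arr_src A (x y x' y' : A) (u : hom x y) (v : hom x' y') :
  arr u = arr v -> x = x'.
Proof. exact: (f_equal (@projT1 _ _)). Qed.

Lemma arr_tgt A (x y x' y' : A) (u : hom x y) (v : hom x' y') :
  arr u = arr v -> y = y'.
Proof. exact: (f_equal (fun z => projT1 (projT2 z))). Qed.

Lemma arr_fmor A B (P : linfunctor A B) (x y x' y' : A) (u : hom x y)
    (v : hom x' y') :
  arr u = arr v -> arr (fmor P u) = arr (fmor P v).
Proof.
exact: (f_equal (fun z : {x : A & {y : A & hom x y}} =>
  arr (fmor P (projT2 (projT2 z))))).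
Qed.

Lemma idto_irr A (x : A) (e : x = x) : idto e = idm x.
Proof. by rewrite (Prop_irrelevance e erefl). Qed.

Lemma idto_symK A (x y : A) (e : x = y) : idto (esym e) \vo idto e = idm x.
Proof. by case: y / e; rewrite vcomp1l. Qed.

Lemma idtoK_sym A (x y : A) (e : x = y) : idto e \vo idto (esym e) = idm y.
Proof. by case: y / e; rewrite vcomp1l. Qed.

Lemma linfunctor_ext A B (P Q : linfunctor A B) :
  (forall x y (u : hom x y), arr (fmor P u) = arr (fmor Q u)) -> P = Q.
Proof.
case: P Q => [po pm p1 pM pl] [qo qm q1 qM ql] /= E.
have eo : po = qo.
  by apply: functional_extensionality_dep => x; apply: arr_src (E x x (idm x)).
case: qo / eo qm q1 qM ql E => qm q1 qM ql E.
have em : pm = qm.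
  do 3! apply: functional_extensionality_dep => ?; exact: arr_inj (E _ _ _).
case: qm / em q1 qM ql E => q1 qM ql E.
by congr LinFunctor; apply: Prop_irrelevance.
Qed.

End LinCatTheory.

Definition isom_id (K : fieldType) (A : lincat K) (x : A) : isom x x :=
  Isom (vcomp1l (idm x)) (vcomp1l (idm x)).

Definition isom_inv (K : fieldType) (A : lincat K) (x y : A) (u : isom x y) :
  isom y x := Isom (fwdK u) (bwdK u).

Lemma isom_compP (K : fieldType) (A : lincat K) (x y z : A)
    (v : isom y z) (u : isom x y) :
  (bwd u \vo bwd v) \vo (v \vo u) = idm x.
Proof. by rewrite vcompA -(vcompA (bwd u)) bwdK vcomp1r bwdK. Qed.

Definition isom_comp (K : fieldType) (A : lincat K) (x y z : A)
    (v : isom y z) (u : isom x y) : isom x z :=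
  Isom (isom_compP v u) (isom_compP (isom_inv u) (isom_inv v)).

Definition isom_idto (K : fieldType) (A : lincat K) (x y : A) (e : x = y) :
  isom x y := Isom (idto_symK e) (idtoK_sym e).

Lemma isom_fmorP (K : fieldType) (A B : lincat K) (P : linfunctor A B)
    (x y : A) (u : isom x y) :
  fmor P (bwd u) \vo fmor P u = idm (P x).
Proof. by rewrite -fmorM bwdK fmor1. Qed.

Definition isom_fmor (K : fieldType) (A B : lincat K) (P : linfunctor A B)
    (x y : A) (u : isom x y) : isom (P x) (P y) :=
  Isom (isom_fmorP P u) (isom_fmorP P (isom_inv u)).

Definition idF (K : fieldType) (A : lincat K) : linfunctor A A :=
  @LinFunctor K A A (fun x => x) (fun x y u => u) (fun x => erefl)
    (fun x y z v u => erefl) (fun x y a u v => erefl).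

Lemma compF_lin (K : fieldType) (A B E : lincat K) (Q : linfunctor B E)
    (P : linfunctor A B) (x y : A) :
  linear (fun u : hom x y => fmor Q (fmor P u)).
Proof. by move=> a u v; rewrite !fmor_lin. Qed.

Lemma compF_1 (K : fieldType) (A B E : lincat K) (Q : linfunctor B E)
    (P : linfunctor A B) (x : A) : fmor Q (fmor P (idm x)) = idm (Q (P x)).
Proof. by rewrite !fmor1. Qed.

Lemma compF_M (K : fieldType) (A B E : lincat K) (Q : linfunctor B E)
    (P : linfunctor A B) (x y z : A) (v : hom y z) (u : hom x y) :
  fmor Q (fmor P (v \vo u)) = fmor Q (fmor P v) \vo fmor Q (fmor P u).
Proof. by rewrite !fmorM. Qed.

Definition compF (K : fieldType) (A B E : lincat K) (Q : linfunctor B E)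
    (P : linfunctor A B) : linfunctor A E :=
  LinFunctor (compF_1 Q P) (compF_M Q P) (compF_lin Q P).

Section NatIso.
Variables (K : fieldType) (A B : lincat K).
Implicit Types P Q R : linfunctor A B.

Lemma idN_nat P x y (u : hom x y) :
  isom_id (P y) \vo fmor P u = fmor P u \vo isom_id (P x).
Proof. by rewrite /= vcomp1l vcomp1r. Qed.

Definition idN P : natiso P P := NatIso (@idN_nat P).

Definition idtoN P Q (e : P = Q) : natiso P Q :=
  match e in _ = R return natiso P R with erefl => idN P end.

Definition natiso_cast P P' Q Q' (eP : P = P') (eQ : Q = Q')
    (t : natiso P Q) : natiso P' Q' :=
  match eP in _ = R, eQ in _ = R' return natiso R R' with
  | erefl, erefl => t
  end.

Lemma compN_nat P Q R (s : natiso Q R) (t : natiso P Q) x y (u : hom x y) :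
  isom_comp (s y) (t y) \vo fmor P u = fmor R u \vo isom_comp (s x) (t x).
Proof. by rewrite /= -vcompA ni_nat vcompA ni_nat vcompA. Qed.

Definition compN P Q R (s : natiso Q R) (t : natiso P Q) : natiso P R :=
  NatIso (compN_nat s t).

Lemma invN_nat P Q (t : natiso P Q) x y (u : hom x y) :
  isom_inv (t y) \vo fmor Q u = fmor P u \vo isom_inv (t x).
Proof.
rewrite /= -[LHS]vcomp1r -(fwdK (t x)) vcompA -(vcompA (bwd (t y))).
by rewrite -ni_nat vcompA bwdK vcomp1l.
Qed.

Definition invN P Q (t : natiso P Q) : natiso Q P := NatIso (invN_nat t).

Lemma whiskN_nat (E : lincat K) (G : linfunctor B E) P Q (t : natiso P Q)
    x y (u : hom x y) :
  isom_fmor G (t y) \vo fmor (compF G P) u =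
  fmor (compF G Q) u \vo isom_fmor G (t x).
Proof. by rewrite /= -!fmorM ni_nat. Qed.

Definition whiskN (E : lincat K) (G : linfunctor B E) P Q (t : natiso P Q) :
  natiso (compF G P) (compF G Q) :=
  @NatIso K A E (compF G P) (compF G Q) (fun x => isom_fmor G (t x))
    (whiskN_nat G t).

End NatIso.

Section One.
Variable K : fieldType.

Lemma one_linl (u : K^o) : linear (fun v : K^o => v * u).
Proof. by move=> a v w; rewrite mulrDl scalerAl. Qed.

Lemma one_linr (v : K^o) : linear (fun u : K^o => v * u).
Proof. by move=> a u w; rewrite mulrDr scalerAr. Qed.

(* The terminal category made K-linear freely: End(tt) = K, so that a linear
   functor out of it amounts to an object of the target. *)
Definition onecat : lincat K :=
  @LinCat K unit (fun _ _ => K^o) (fun _ => 1) (fun _ _ _ v u => v * u)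
    (fun _ _ u => mul1r u) (fun _ _ u => mulr1 u)
    (fun _ _ _ _ w v u => mulrA w v u)
    (fun _ _ _ u => one_linl u) (fun _ _ _ v => one_linr v).

Variables (A : lincat K) (x : A).

Lemma pick_M (b a : K) :
  (b * a) *: idm x = (b *: idm x) \vo (a *: idm x).
Proof. by rewrite vcompZl vcompZr vcomp1l scalerA. Qed.

Lemma pick_lin : linear (fun a : K^o => a *: idm x).
Proof. by move=> a u v; rewrite scalerDl scalerA. Qed.

Definition pick_functor : linfunctor onecat A :=
  @LinFunctor K onecat A (fun _ => x) (fun _ _ a => a *: idm x)
    (fun _ => scale1r (idm x)) (fun _ _ _ b a => pick_M b a)
    (fun _ _ => pick_lin).

Lemma one_fmor (P : linfunctor onecat A) (a : @hom K onecat tt tt) :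
  fmor P a = a *: idm (P tt).
Proof.
have {1}-> : a = (a : K) *: (idm (tt : onecat)) by exact: esym (mulr1 _).
by rewrite fmorZ fmor1.
Qed.

Lemma one_nat (P Q : linfunctor onecat A) (t : isom (P tt) (Q tt))
    (x0 y0 : onecat) (u : hom x0 y0) :
  (match y0 return isom (P y0) (Q y0) with tt => t end) \vo fmor P u =
  fmor Q u \vo (match x0 return isom (P x0) (Q x0) with tt => t end).
Proof.
case: x0 y0 u => [] [] u.
by rewrite !one_fmor vcompZl vcompZr vcomp1l vcomp1r.
Qed.

Definition one_natiso (P Q : linfunctor onecat A) (t : isom (P tt) (Q tt)) :
  natiso P Q := NatIso (@one_nat P Q t).

End One.

Record twocat (K : fieldType) := TwoCat {
  cell0 :> Type;
  cell1 : cell0 -> cell0 -> lincat K;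
  id1 : forall X, cell1 X X;
  comp1 : forall X Y Z, cell1 Y Z -> cell1 X Y -> cell1 X Z;
  comp2 : forall X Y Z (g g' : cell1 Y Z) (f f' : cell1 X Y),
    hom g g' -> hom f f' -> hom (comp1 g f) (comp1 g' f');
  comp2_id : forall X Y Z (g : cell1 Y Z) (f : cell1 X Y),
    comp2 (idm g) (idm f) = idm (comp1 g f);
  comp2_vcomp : forall X Y Z (g g' g'' : cell1 Y Z) (f f' f'' : cell1 X Y)
      (b' : hom g' g'') (b : hom g g') (a' : hom f' f'') (a : hom f f'),
    comp2 (b' \vo b) (a' \vo a) = comp2 b' a' \vo comp2 b a;
  comp2_linl : forall X Y Z (g g' : cell1 Y Z) (f f' : cell1 X Y)
      (a : hom f f'),
    linear (fun b : hom g g' => comp2 b a);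
  comp2_linr : forall X Y Z (g g' : cell1 Y Z) (f f' : cell1 X Y)
      (b : hom g g'),
    linear (fun a : hom f f' => comp2 b a);
  comp1A : forall X Y Z T (h : cell1 Z T) (g : cell1 Y Z) (f : cell1 X Y),
    comp1 h (comp1 g f) = comp1 (comp1 h g) f;
  comp2A : forall X Y Z T (h h' : cell1 Z T) (g g' : cell1 Y Z)
      (f f' : cell1 X Y) (c : hom h h') (b : hom g g') (a : hom f f'),
    arr (comp2 c (comp2 b a)) = arr (comp2 (comp2 c b) a);
  comp1_1l : forall X Y (f : cell1 X Y), comp1 (id1 Y) f = f;
  comp2_1l : forall X Y (f f' : cell1 X Y) (a : hom f f'),
    arr (comp2 (idm (id1 Y)) a) = arr a;
  comp1_1r : forall X Y (f : cell1 X Y), comp1 f (id1 X) = f;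
  comp2_1r : forall X Y (f f' : cell1 X Y) (a : hom f f'),
    arr (comp2 a (idm (id1 X))) = arr a }.

Arguments cell1 {K} t _ _.
Arguments id1 {K} t X.
Arguments comp1 {K t X Y Z} _ _.
Arguments comp2 {K t X Y Z g g' f f'} _ _.
Notation "g \co f" := (comp1 g f).
Notation "b \ho a" := (comp2 b a).

Record pseudofunctor (K : fieldType) (C D : twocat K) := PseudoFunctor {
  pob :> C -> D;
  pfun : forall X Y : C, linfunctor (cell1 C X Y) (cell1 D (pob X) (pob Y));
  phat : forall (X Y Z : C) (f : cell1 C X Y) (g : cell1 C Y Z),
    isom (pfun Y Z g \co pfun X Y f) (pfun X Z (g \co f));
  phat_nat : forall (X Y Z : C) (f f' : cell1 C X Y) (g g' : cell1 C Y Z)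
      (a : hom f f') (b : hom g g'),
    phat f' g' \vo (fmor (pfun Y Z) b \ho fmor (pfun X Y) a) =
    fmor (pfun X Z) (b \ho a) \vo phat f g;
  pzero : forall X : C, isom (pfun X X (id1 C X)) (id1 D (pob X));
  phatA : forall (X Y Z T : C) (f : cell1 C X Y) (g : cell1 C Y Z)
      (l : cell1 C Z T),
    arr (phat (g \co f) l \vo (idm (pfun Z T l) \ho phat f g)) =
    arr (phat f (l \co g) \vo (phat g l \ho idm (pfun X Y f)));
  phat_1r : forall (X Y : C) (f : cell1 C X Y),
    arr (phat (id1 C X) f) = arr (idm (pfun X Y f) \ho pzero X);
  phat_1l : forall (X Y : C) (f : cell1 C X Y),
    arr (phat f (id1 C Y)) = arr (pzero Y \ho idm (pfun X Y f)) }.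

Arguments pfun {K C D} p {X Y}.
Arguments phat {K C D} p {X Y Z} f g.

Section TwoCatTheory.
Variables (K : fieldType) (D : twocat K).

Lemma arr_comp2 (X Y Z : D) (g g' h h' : cell1 D Y Z) (f f' k k' : cell1 D X Y)
    (b : hom g g') (d : hom h h') (a : hom f f') (c : hom k k') :
  arr b = arr d -> arr a = arr c -> arr (b \ho a) = arr (d \ho c).
Proof.
move=> Eb Ea.
pose G (z : {x : cell1 D Y Z & {y : cell1 D Y Z & hom x y}})
  (t : {x : cell1 D X Y & {y : cell1 D X Y & hom x y}}) :=
  arr (projT2 (projT2 z) \ho projT2 (projT2 t)).
exact: (f_equal2 G Eb Ea).
Qed.

Lemma isom_comp2P (X Y Z : D) (g g' : cell1 D Y Z) (f f' : cell1 D X Y)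
    (b : isom g g') (a : isom f f') :
  (bwd b \ho bwd a) \vo (b \ho a) = idm (g \co f).
Proof. by rewrite -comp2_vcomp !bwdK comp2_id. Qed.

Definition isom_comp2 (X Y Z : D) (g g' : cell1 D Y Z) (f f' : cell1 D X Y)
    (b : isom g g') (a : isom f f') : isom (g \co f) (g' \co f') :=
  Isom (isom_comp2P b a) (isom_comp2P (isom_inv b) (isom_inv a)).

End TwoCatTheory.

(* The data of a complex vanishing in negative degrees; that the coboundary
   squares to zero is not recorded. *)
Record cochains (K : fieldType) := Cochains {
  cmod : nat -> lmodType K;
  cobd : forall n, cmod n -> cmod n.+1;
  cobd_lin : forall n, linear (@cobd n) }.

(* [face n i] is the coface usually written O^i_{n+1}; [coherer n i j], for
   i <= j, is the coherer usually written tau^{n+1}_{i,j+1}, for i < j+1: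
   as naturals, [lift ord0 j] is j.+1 and [widen_ord _ i] is i. *)
Record cosemi2 (K : fieldType) := Cosemi2 {
  cosemi_cat :> nat -> lincat K;
  face : forall n, 'I_n.+2 -> linfunctor (cosemi_cat n) (cosemi_cat n.+1);
  coherer : forall n (i j : 'I_n.+2) (le_ij : (i <= j)%N),
    natiso (compF (face (lift ord0 j)) (face i))
           (compF (face (widen_ord (leqnSn n.+2) i)) (face j));
  enhancement : natiso (@face 0 ord_max) (@face 0 ord0) }.

Arguments face {K} c {n} i.
Arguments coherer {K} c {n i j} le_ij.
Arguments enhancement {K} c.

Section Canonical.
Variables (K : fieldType) (S : cosemi2 K).

(* Tuples (i_1, ..., i_n) with 0 <= i_q <= q, the last entry outermost *)
Fixpoint word (n : nat) : Type :=
  if n is n'.+1 then (word n' * 'I_n'.+2)%type else unit.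

Fixpoint faces (n : nat) : word n -> linfunctor (S 0) (S n) :=
  match n return word n -> linfunctor (S 0) (S n) with
  | 0 => fun _ => idF (S 0)
  | n'.+1 => fun w => compF (face S w.2) (faces w.1)
  end.

Definition whisk_coherer n (w : word n) (i j : 'I_n.+2) (le_ij : (i <= j)%N) :
    natiso (@faces n.+2 ((w, i), lift ord0 j))
           (@faces n.+2 ((w, j), widen_ord (leqnSn n.+2) i)) :=
  let t := coherer S le_ij in
  @NatIso K _ _ (@faces n.+2 ((w, i), lift ord0 j))
    (@faces n.+2 ((w, j), widen_ord (leqnSn n.+2) i))
    (fun x => t (faces w x)) (fun x y u => ni_nat t (fmor (faces w) u)).

Definition whisk_enhancement :
    natiso (@faces 1 (tt, ord_max)) (@faces 1 (tt, ord0)) :=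
  let t := enhancement S in
  @NatIso K _ _ (@faces 1 (tt, ord_max)) (@faces 1 (tt, ord0))
    (fun x => t x) (fun x y u => ni_nat t u).

Definition whisk_face n (w w' : word n) (i : 'I_n.+2)
    (t : natiso (faces w) (faces w')) :
    natiso (@faces n.+1 (w, i)) (@faces n.+1 (w', i)) :=
  whiskN (face S i) t.

Inductive elementary : forall n (w w' : word n), natiso (faces w) (faces w') -> Prop :=
| elementary_coherer n (w : word n) (i j : 'I_n.+2) (le_ij : (i <= j)%N) :
    @elementary n.+2 ((w, i), lift ord0 j) ((w, j), widen_ord (leqnSn n.+2) i)
      (whisk_coherer w le_ij)
| elementary_enhancement :
    @elementary 1 (tt, ord_max) (tt, ord0) whisk_enhancement
| elementary_inv n (w w' : word n) (t : natiso (faces w) (faces w')) :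
    elementary t -> elementary (invN t)
| elementary_face n (w w' : word n) (i : 'I_n.+2) (t : natiso (faces w) (faces w')) :
    elementary t -> @elementary n.+1 (w, i) (w', i) (whisk_face i t).

Inductive canonical n :
  forall w w' : word n, natiso (faces w) (faces w') -> Prop :=
| canonical_id w : canonical (idN (faces w))
| canonical_step (w w' w'' : word n) (t : natiso (faces w) (faces w'))
    (s : natiso (faces w') (faces w'')) :
    canonical t -> elementary s -> canonical (compN s t).

Let linked n (w w' : word n) := exists t, @canonical n w w' t.

Let linked_refl n (w : word n) : linked w w.
Proof. by exists (idN _); apply: canonical_id. Qed.

Let linked_step n (w w' : word n) t : @elementary n w w' t -> linked w w'.
Proof.
move=> mt; exists (compN t (idN _)).
exact: canonical_step (canonical_id _) mt.
Qed.

Let linked_trans n (v w w' : word n) : linked v w -> linked w w' -> linked v w'.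
Proof.
move=> lvw [t ct]; elim: ct lvw => // w1 w2 w3 {}t s _ IH ms /IH[r cr].
by exists (compN s r); apply: canonical_step cr ms.
Qed.

Let linked_sym n (w w' : word n) : linked w w' -> linked w' w.
Proof.
case=> t; elim=> [v|w1 w2 w3 {}t s _ IH ms]; first exact: linked_refl.
by apply: linked_trans IH; apply: linked_step (elementary_inv ms).
Qed.

Let linked_face n (w w' : word n) i :
  linked w w' -> @linked n.+1 (w, i) (w', i).
Proof.
case=> t; elim=> [v|w1 w2 w3 {}t s _ IH ms]; first exact: linked_refl.
by apply: linked_trans IH _; apply: linked_step (elementary_face i ms).
Qed.

Let zerow (n : nat) : word n :=
  (fix z n : word n := if n is n'.+1 then (z n', ord0) else tt) n.

Let linked_zero n (w : word n) : linked w (zerow n).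
Proof.
elim: n w => [|n IH]; first by case; apply: linked_refl.
case=> w i; case: (unliftP ord0 i) => [j|] ->; last exact: linked_face.
case: n IH w i j => [|n] IH w i j.
  case: w => {i}; have -> : lift ord0 j = ord_max.
    by apply: val_inj; rewrite /= /bump; case: j => [[|[]]].
  exact: linked_step elementary_enhancement.
have := IH ((zerow n, ord0) : word n.+1).
move=> /linked_sym/(linked_trans (IH w))/(linked_face (lift ord0 j)) l1.
apply: linked_trans l1 _.
apply: linked_trans (linked_step (@elementary_coherer n (zerow n) ord0 j (leq0n j))) _.
rewrite (_ : widen_ord _ _ = ord0); last exact: val_inj.
exact: linked_face (IH ((zerow n, j) : word n.+1)).
Qed.

Lemma canonical_exists n (w w' : word n) : exists t, @canonical n w w' t.
Proof.
exact: linked_trans (linked_zero w) (linked_sym (linked_zero w')).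
Qed.

(* Some canonical isomorphism, of which nothing else is known; by coherence it
   is the only one. *)
Definition tauphi n (w w' : word n) : natiso (faces w) (faces w') :=
  projT1 (cid (canonical_exists w w')).

Lemma tauphiP n (w w' : word n) : canonical (tauphi w w').
Proof. by rewrite /tauphi; case: cid. Qed.

Fixpoint refword (n : nat) : word n :=
  if n is n'.+1 then (refword n', ord_max) else tt.

Fixpoint refword' (n : nat) : word n :=
  if n is n'.+1 then (refword' n', Ordinal (leqnSn n'.+1)) else tt.

Variable x0 : S 0.

(* X_0 = x0, X_{n+1} = O^{n+1}_{n+1}(X_n) and
   X'_0 = x0, X'_{n+1} = O^n_{n+1}(X'_n), by computation *)
Definition refob n : S n := faces (refword n) x0.
Definition refob' n : S n := faces (refword' n) x0.

Definition assoc_mod (n : nat) : lmodType K :=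
  match n with 0 => 'rV[K]_0 | n'.+1 => hom (refob n'.+1) (refob' n'.+1) end.

Definition assoc_alpha n (i : 'I_n.+2) :
    hom (face S i (refob' n)) (refob' n.+1) :=
  tauphi ((refword' n, i) : word n.+1) (refword' n.+1) x0.

Definition assoc_beta n (i : 'I_n.+2) :
    hom (refob n.+1) (face S i (refob n)) :=
  tauphi (refword n.+1) ((refword n, i) : word n.+1) x0.

Definition assoc_cobd (n : nat) : assoc_mod n -> assoc_mod n.+1 :=
  match n return assoc_mod n -> assoc_mod n.+1 with
  | 0 => fun _ => 0
  | n'.+1 => fun phi => \sum_(i < n'.+3) (-1) ^+ i *:
      (assoc_alpha i \vo fmor (face S i) phi \vo assoc_beta i)
  end.

Lemma assoc_cobd_lin n : linear (@assoc_cobd n).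
Proof.
case: n => [|n] a u v /=; first by rewrite scaler0 addr0.
rewrite scaler_sumr -big_split /=; apply: eq_bigr => i _.
rewrite fmor_lin vcompDr vcompZr vcompDl vcompZl scalerDr !scalerA.
by rewrite mulrC.
Qed.

Definition assoc_complex : cochains K := Cochains assoc_cobd_lin.

End Canonical.

Section Strings.
Variables (K : fieldType) (C : twocat K).

(* The n intermediate objects of a string of n.+1 composable 1-cells; the end
   points are kept apart, so that they are preserved definitionally by
   composition at an intermediate object. *)
Fixpoint mids (n : nat) : Type :=
  if n is n'.+1 then (C * mids n')%type else unit.

(* Objects of C(X_0, X_1) x ... x C(X_n, X_{n+1}), where X_0 = X,
   (X_1, ..., X_n) = m and X_{n+1} = Y. *)
Fixpoint chain (n : nat) : C -> mids n -> C -> Type :=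
  match n return C -> mids n -> C -> Type with
  | 0 => fun X _ Y => cell1 C X Y
  | n'.+1 => fun X m Y => (cell1 C X m.1 * chain m.1 m.2 Y)%type
  end.

Fixpoint chain2 (n : nat) :
    forall (X : C) (m : mids n) (Y : C), chain X m Y -> chain X m Y -> Type :=
  match n return forall (X : C) (m : mids n) (Y : C),
      chain X m Y -> chain X m Y -> Type with
  | 0 => fun X _ Y c c' => @hom K (cell1 C X Y) c c'
  | n'.+1 => fun X m Y c c' => (hom c.1 c'.1 * chain2 c.2 c'.2)%type
  end.

Fixpoint id2 (n : nat) :
    forall (X : C) (m : mids n) (Y : C) (c : chain X m Y), chain2 c c :=
  match n return forall (X : C) (m : mids n) (Y : C) (c : chain X m Y),
      chain2 c c with
  | 0 => fun X _ Y c => @idm K (cell1 C X Y) c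
  | n'.+1 => fun X m Y c => (idm c.1, id2 c.2)
  end.

Fixpoint vcomp2 (n : nat) :
    forall (X : C) (m : mids n) (Y : C) (c c' c'' : chain X m Y),
      chain2 c' c'' -> chain2 c c' -> chain2 c c'' :=
  match n return forall (X : C) (m : mids n) (Y : C) (c c' c'' : chain X m Y),
      chain2 c' c'' -> chain2 c c' -> chain2 c c'' with
  | 0 => fun X _ Y c c' c'' v u => @vcomp K (cell1 C X Y) c c' c'' v u
  | n'.+1 => fun X m Y c c' c'' v u => (v.1 \vo u.1, vcomp2 v.2 u.2)
  end.

Fixpoint multilinear (V : lmodType K) (n : nat) :
    forall (X : C) (m : mids n) (Y : C) (c c' : chain X m Y),
      (chain2 c c' -> V) -> Prop :=
  match n return forall (X : C) (m : mids n) (Y : C) (c c' : chain X m Y),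
      (chain2 c c' -> V) -> Prop with
  | 0 => fun X _ Y c c' P => linear (P : @hom K (cell1 C X Y) c c' -> V)
  | n'.+1 => fun X m Y c c' P =>
      (forall b : chain2 c.2 c'.2, linear (fun a : hom c.1 c'.1 => P (a, b)))
      /\ (forall a : hom c.1 c'.1,
            multilinear (fun b : chain2 c.2 c'.2 => P (a, b)))
  end.

(* Composition at the vertex X_{i+1}, for i < n.+1 (larger i act as n) *)
Fixpoint del (n i : nat) : mids n.+1 -> mids n :=
  match n, i return mids n.+1 -> mids n with
  | n'.+1, i'.+1 => fun m => (m.1, del i' m.2)
  | _, _ => fun m => m.2
  end.

Fixpoint ctr (n i : nat) : forall (X : C) (m : mids n.+1) (Y : C),
    chain X m Y -> chain X (del i m) Y :=
  match n, i return forall (X : C) (m : mids n.+1) (Y : C),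
    chain X m Y -> chain X (del i m) Y with
  | 0, _ => fun X m Y c => c.2 \co c.1
  | n'.+1, 0 => fun X m Y c => (c.2.1 \co c.1, c.2.2)
  | n'.+1, i'.+1 => fun X m Y c => (c.1, ctr i' c.2)
  end.

Fixpoint ctr2 (n i : nat) : forall (X : C) (m : mids n.+1) (Y : C)
    (c c' : chain X m Y), chain2 c c' -> chain2 (ctr i c) (ctr i c') :=
  match n, i return forall (X : C) (m : mids n.+1) (Y : C)
    (c c' : chain X m Y), chain2 c c' -> chain2 (ctr i c) (ctr i c') with
  | 0, _ => fun X m Y c c' a => a.2 \ho a.1
  | n'.+1, 0 => fun X m Y c c' a => (a.2.1 \ho a.1, a.2.2)
  | n'.+1, i'.+1 => fun X m Y c c' a => (a.1, ctr2 i' a.2)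
  end.

(* Splitting a string at its k-th intermediate object, into its first k.+1
   and its last n.+1 1-cells *)
Fixpoint mtake (k n : nat) : mids (k + n.+1) -> mids k :=
  match k return mids (k + n.+1) -> mids k with
  | 0 => fun _ => tt
  | k'.+1 => fun m => (m.1, mtake m.2)
  end.

Fixpoint mnth (k n : nat) : mids (k + n.+1) -> C :=
  match k return mids (k + n.+1) -> C with
  | 0 => fun m => m.1
  | k'.+1 => fun m => mnth m.2
  end.

Fixpoint mdrop (k n : nat) : mids (k + n.+1) -> mids n :=
  match k return mids (k + n.+1) -> mids n with
  | 0 => fun m => m.2
  | k'.+1 => fun m => mdrop m.2
  end.

Fixpoint ctake (k n : nat) : forall (X : C) (m : mids (k + n.+1)) (Y : C),
    chain X m Y -> chain X (mtake m) (mnth m) :=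
  match k return forall (X : C) (m : mids (k + n.+1)) (Y : C),
    chain X m Y -> chain X (mtake m) (mnth m) with
  | 0 => fun X m Y c => c.1
  | k'.+1 => fun X m Y c => (c.1, ctake c.2)
  end.

Fixpoint cdrop (k n : nat) : forall (X : C) (m : mids (k + n.+1)) (Y : C),
    chain X m Y -> chain (mnth m) (mdrop m) Y :=
  match k return forall (X : C) (m : mids (k + n.+1)) (Y : C),
    chain X m Y -> chain (mnth m) (mdrop m) Y with
  | 0 => fun X m Y c => c.2
  | k'.+1 => fun X m Y c => cdrop c.2
  end.

Fixpoint ctake2 (k n : nat) : forall (X : C) (m : mids (k + n.+1)) (Y : C)
    (c c' : chain X m Y), chain2 c c' -> chain2 (ctake c) (ctake c') :=
  match k return forall (X : C) (m : mids (k + n.+1)) (Y : C)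
    (c c' : chain X m Y), chain2 c c' -> chain2 (ctake c) (ctake c') with
  | 0 => fun X m Y c c' a => a.1
  | k'.+1 => fun X m Y c c' a => (a.1, ctake2 a.2)
  end.

Fixpoint cdrop2 (k n : nat) : forall (X : C) (m : mids (k + n.+1)) (Y : C)
    (c c' : chain X m Y), chain2 c c' -> chain2 (cdrop c) (cdrop c') :=
  match k return forall (X : C) (m : mids (k + n.+1)) (Y : C)
    (c c' : chain X m Y), chain2 c c' -> chain2 (cdrop c) (cdrop c') with
  | 0 => fun X m Y c c' a => a.2
  | k'.+1 => fun X m Y c c' a => cdrop2 a.2
  end.

Fixpoint minit (n : nat) : mids n.+1 -> mids n :=
  match n return mids n.+1 -> mids n with
  | 0 => fun _ => tt
  | n'.+1 => fun m => (m.1, minit m.2)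
  end.

Fixpoint mlast (n : nat) : mids n.+1 -> C :=
  match n return mids n.+1 -> C with
  | 0 => fun m => m.1
  | n'.+1 => fun m => mlast m.2
  end.

Fixpoint cinit (n : nat) : forall (X : C) (m : mids n.+1) (Y : C),
    chain X m Y -> chain X (minit m) (mlast m) :=
  match n return forall (X : C) (m : mids n.+1) (Y : C),
    chain X m Y -> chain X (minit m) (mlast m) with
  | 0 => fun X m Y c => c.1
  | n'.+1 => fun X m Y c => (c.1, cinit c.2)
  end.

Fixpoint clast (n : nat) : forall (X : C) (m : mids n.+1) (Y : C),
    chain X m Y -> cell1 C (mlast m) Y :=
  match n return forall (X : C) (m : mids n.+1) (Y : C),
    chain X m Y -> cell1 C (mlast m) Y with
  | 0 => fun X m Y c => c.2
  | n'.+1 => fun X m Y c => clast c.2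
  end.

Fixpoint cinit2 (n : nat) : forall (X : C) (m : mids n.+1) (Y : C)
    (c c' : chain X m Y), chain2 c c' -> chain2 (cinit c) (cinit c') :=
  match n return forall (X : C) (m : mids n.+1) (Y : C)
    (c c' : chain X m Y), chain2 c c' -> chain2 (cinit c) (cinit c') with
  | 0 => fun X m Y c c' a => a.1
  | n'.+1 => fun X m Y c c' a => (a.1, cinit2 a.2)
  end.

Fixpoint clast2 (n : nat) : forall (X : C) (m : mids n.+1) (Y : C)
    (c c' : chain X m Y), chain2 c c' -> hom (clast c) (clast c') :=
  match n return forall (X : C) (m : mids n.+1) (Y : C)
    (c c' : chain X m Y), chain2 c c' -> hom (clast c) (clast c') with
  | 0 => fun X m Y c c' a => a.2
  | n'.+1 => fun X m Y c c' a => clast2 a.2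
  end.

Lemma ctr2_id n i X (m : mids n.+1) Y (c : chain X m Y) :
  ctr2 i (id2 c) = id2 (ctr i c).
Proof.
elim: n i X m c => [|n IH] [|i] X m c //=; rewrite ?comp2_id //.
by rewrite IH.
Qed.

Lemma ctr2_vcomp n i X (m : mids n.+1) Y (c c' c'' : chain X m Y)
    (v : chain2 c' c'') (u : chain2 c c') :
  ctr2 i (vcomp2 v u) = vcomp2 (ctr2 i v) (ctr2 i u).
Proof.
elim: n i X m c c' c'' v u => [|n IH] [|i] X m c c' c'' v u //=;
  rewrite ?comp2_vcomp //.
by rewrite IH.
Qed.

Lemma ctake2_id k n X (m : mids (k + n.+1)) Y (c : chain X m Y) :
  ctake2 (id2 c) = id2 (ctake c).
Proof. by elim: k X m c => [|k IH] X m c //=; rewrite IH. Qed.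

Lemma cdrop2_id k n X (m : mids (k + n.+1)) Y (c : chain X m Y) :
  cdrop2 (id2 c) = id2 (cdrop c).
Proof. by elim: k X m c => [|k IH] X m c //=; rewrite IH. Qed.

Lemma ctake2_vcomp k n X (m : mids (k + n.+1)) Y (c c' c'' : chain X m Y)
    (v : chain2 c' c'') (u : chain2 c c') :
  ctake2 (vcomp2 v u) = vcomp2 (ctake2 v) (ctake2 u).
Proof.
by elim: k X m c c' c'' v u => [|k IH] X m c c' c'' v u //=; rewrite IH.
Qed.

Lemma cdrop2_vcomp k n X (m : mids (k + n.+1)) Y (c c' c'' : chain X m Y)
    (v : chain2 c' c'') (u : chain2 c c') :
  cdrop2 (vcomp2 v u) = vcomp2 (cdrop2 v) (cdrop2 u).
Proof.
by elim: k X m c c' c'' v u => [|k IH] X m c c' c'' v u //=; rewrite IH.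
Qed.

Lemma cinit2_id n X (m : mids n.+1) Y (c : chain X m Y) :
  cinit2 (id2 c) = id2 (cinit c).
Proof. by elim: n X m c => [|n IH] X m c //=; rewrite IH. Qed.

Lemma clast2_id n X (m : mids n.+1) Y (c : chain X m Y) :
  clast2 (id2 c) = idm (clast c).
Proof. by elim: n X m c => [|n IH] X m c //=; rewrite IH. Qed.

Lemma cinit2_vcomp n X (m : mids n.+1) Y (c c' c'' : chain X m Y)
    (v : chain2 c' c'') (u : chain2 c c') :
  cinit2 (vcomp2 v u) = vcomp2 (cinit2 v) (cinit2 u).
Proof.
by elim: n X m c c' c'' v u => [|n IH] X m c c' c'' v u //=; rewrite IH.
Qed.

Lemma clast2_vcomp n X (m : mids n.+1) Y (c c' c'' : chain X m Y)
    (v : chain2 c' c'') (u : chain2 c c') :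
  clast2 (vcomp2 v u) = clast2 v \vo clast2 u.
Proof.
by elim: n X m c c' c'' v u => [|n IH] X m c c' c'' v u //=; rewrite IH.
Qed.

Lemma vcomp2_1l n X (m : mids n) Y (c c' : chain X m Y) (u : chain2 c c') :
  vcomp2 (id2 c') u = u.
Proof.
elim: n X m c c' u => [|n IH] X m c c' u /=; rewrite ?vcomp1l //.
by rewrite IH; case: u.
Qed.

Lemma vcomp2_1r n X (m : mids n) Y (c c' : chain X m Y) (u : chain2 c c') :
  vcomp2 u (id2 c) = u.
Proof.
elim: n X m c c' u => [|n IH] X m c c' u /=; rewrite ?vcomp1r //.
by rewrite IH; case: u.
Qed.

Lemma multilinear_linear (V W : lmodType K) (T : V -> W) n X (m : mids n) Y
    (c c' : chain X m Y) (P : chain2 c c' -> V) :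
  linear T -> multilinear P -> multilinear (fun a => T (P a)).
Proof.
move=> linT; elim: n X m c c' P => [|n IH] X m c c' P /=.
  by move=> linP a u v; rewrite linP linT.
case=> lin1 lin2; split=> [b a u v|a]; first by rewrite lin1 linT.
exact: (IH _ _ _ _ _ (lin2 a)).
Qed.

Lemma multilinear_ctr (V : lmodType K) n i X (m : mids n.+1) Y
    (c c' : chain X m Y) (P : chain2 (ctr i c) (ctr i c') -> V) :
  multilinear P -> multilinear (fun a : chain2 c c' => P (ctr2 i a)).
Proof.
elim: n i X m c c' P => [|n IH] [|i] X m c c' P /=.
- by move=> linP; split=> [b|a] t u v; rewrite ?comp2_linl ?comp2_linr linP.
- by move=> linP; split=> [b|a] t u v; rewrite ?comp2_linl ?comp2_linr linP.
- case=> lin1 lin2; split=> [b t u v|a]; first by rewrite comp2_linr lin1.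
  split=> [b t u v|b]; first by rewrite comp2_linl lin1.
  exact: lin2.
case=> lin1 lin2; split=> [b t u v|a]; first by rewrite lin1.
exact: (IH i _ _ _ _ _ (lin2 a)).
Qed.

Definition bilinear_op (U V W : lmodType K) (T : U -> V -> W) :=
  (forall v, linear (fun u => T u v)) /\ (forall u, linear (T u)).

Lemma multilinear_take_drop (U V W : lmodType K) (T : U -> V -> W) k n X
    (m : mids (k + n.+1)) Y (c c' : chain X m Y)
    (P : chain2 (ctake c) (ctake c') -> V)
    (Q : chain2 (cdrop c) (cdrop c') -> U) :
  bilinear_op T -> multilinear P -> multilinear Q ->
  multilinear (fun a : chain2 c c' => T (Q (cdrop2 a)) (P (ctake2 a))).
Proof.
move=> [linTl linTr]; elim: k X m c c' P Q => [|k IH] X m c c' P Q /=.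
  move=> linP linQ; split=> [b t u v|a]; first by rewrite linP linTr.
  exact: (multilinear_linear (linTl _) linQ).
case=> lin1 lin2 linQ; split=> [b t u v|a]; first by rewrite lin1 linTr.
exact: (IH _ _ _ _ _ _ (lin2 a) linQ).
Qed.

Lemma multilinear_init_last (U V W : lmodType K) (T : U -> V -> W) n X
    (m : mids n.+1) Y (c c' : chain X m Y)
    (P : chain2 (cinit c) (cinit c') -> V)
    (Q : hom (clast c) (clast c') -> U) :
  bilinear_op T -> multilinear P -> linear Q ->
  multilinear (fun a : chain2 c c' => T (Q (clast2 a)) (P (cinit2 a))).
Proof.
move=> [linTl linTr]; elim: n X m c c' P Q => [|n IH] X m c c' P Q /=.
  by move=> linP linQ; split=> [b|a] t u v; rewrite ?linP ?linQ ?linTr ?linTl.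
case=> lin1 lin2 linQ; split=> [b t u v|a]; first by rewrite lin1 linTr.
exact: (IH _ _ _ _ _ _ (lin2 a) linQ).
Qed.

End Strings.

Arguments del {K C n} i m.
Arguments ctr {K C n} i {X m Y} c.
Arguments ctr2 {K C n} i {X m Y c c'} a.

(* A family of multilinear functors
   C(X_0, X_1) x ... x C(X_n, X_{n+1}) -> E(p X_0, p X_{n+1}). *)
Record multifun (K : fieldType) (C E : twocat K) (p : C -> E) (n : nat) :=
  MultiFun {
  mob : forall X (m : mids C n) Y, chain X m Y -> cell1 E (p X) (p Y);
  mmor : forall X (m : mids C n) Y (c c' : chain X m Y),
    chain2 c c' -> hom (mob c) (mob c');
  mmor1 : forall X (m : mids C n) Y (c : chain X m Y),
    mmor (id2 c) = idm (mob c);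
  mmorM : forall X (m : mids C n) Y (c c' c'' : chain X m Y)
      (v : chain2 c' c'') (u : chain2 c c'),
    mmor (vcomp2 v u) = mmor v \vo mmor u;
  mmor_lin : forall X (m : mids C n) Y (c c' : chain X m Y),
    multilinear (@mmor X m Y c c') }.

Arguments mob {K C E p n} _ {X m Y} c.
Arguments mmor {K C E p n} _ {X m Y c c'} a.

Lemma bilinear_comp2 (K : fieldType) (D : twocat K) (X Y Z : D)
    (g g' : cell1 D Y Z) (f f' : cell1 D X Y) :
  bilinear_op (fun (b : hom g g') (a : hom f f') => b \ho a).
Proof. by split=> [a|b]; [apply: comp2_linl | apply: comp2_linr]. Qed.

Lemma multifun_ext (K : fieldType) (C E : twocat K) (p : C -> E) n
    (H H' : multifun p n) :
  (forall X (m : mids C n) Y (c c' : chain X m Y) (a : chain2 c c'),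
     arr (mmor H a) = arr (mmor H' a)) -> H = H'.
Proof.
case: H H' => [ho hm h1 hM hl] [ko km k1 kM kl] /= E0.
have eo : ho = ko.
  do 4! apply: functional_extensionality_dep => ?.
  exact: arr_src (E0 _ _ _ _ _ (id2 _)).
case: ko / eo km k1 kM kl E0 => km k1 kM kl E0.
have em : hm = km.
  do 6! apply: functional_extensionality_dep => ?.
  exact: arr_inj (E0 _ _ _ _ _ _).
case: km / em k1 kM kl E0 => k1 kM kl E0.
by congr MultiFun; apply: Prop_irrelevance.
Qed.

Section MultiFunOps.
Variables (K : fieldType) (C E : twocat K) (p : C -> E).

(* c^E o (G x H), with G applied to the first k.+1 1-cells and H to the rest *)
Section Join.
Variables (k n : nat) (G : multifun p k) (H : multifun p n).

Definition join_ob X (m : mids C (k + n.+1)) Y (c : chain X m Y) :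
  cell1 E (p X) (p Y) := mob H (cdrop c) \co mob G (ctake c).

Definition join_mor X (m : mids C (k + n.+1)) Y (c c' : chain X m Y)
    (a : chain2 c c') : hom (join_ob c) (join_ob c') :=
  mmor H (cdrop2 a) \ho mmor G (ctake2 a).

Lemma join1 X (m : mids C (k + n.+1)) Y (c : chain X m Y) :
  join_mor (id2 c) = idm (join_ob c).
Proof. by rewrite /join_mor cdrop2_id ctake2_id !mmor1 comp2_id. Qed.

Lemma joinM X (m : mids C (k + n.+1)) Y (c c' c'' : chain X m Y)
    (v : chain2 c' c'') (u : chain2 c c') :
  join_mor (vcomp2 v u) = join_mor v \vo join_mor u.
Proof.
by rewrite /join_mor cdrop2_vcomp ctake2_vcomp !mmorM comp2_vcomp.
Qed.

Lemma join_lin X (m : mids C (k + n.+1)) Y (c c' : chain X m Y) :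
  multilinear (@join_mor X m Y c c').
Proof.
apply: (multilinear_take_drop (@bilinear_comp2 K E _ _ _ _ _ _ _));
  exact: mmor_lin.
Qed.

Definition join : multifun p (k + n.+1) := MultiFun join1 joinM join_lin.

End Join.

(* c^E o (H x G), with G applied to the last 1-cell and H to the rest *)
Section JoinLast.
Variables (n : nat) (H : multifun p n) (G : multifun p 0).

Definition joinl_ob X (m : mids C n.+1) Y (c : chain X m Y) :
    cell1 E (p X) (p Y) :=
  mob G (clast c : chain (mlast m) (tt : mids C 0) Y) \co mob H (cinit c).

Definition joinl_mor X (m : mids C n.+1) Y (c c' : chain X m Y)
    (a : chain2 c c') : hom (joinl_ob c) (joinl_ob c') :=
  @mmor K C E p 0 G (mlast m) tt Y (clast c) (clast c') (clast2 a)
    \ho mmor H (cinit2 a).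

Lemma joinl1 X (m : mids C n.+1) Y (c : chain X m Y) :
  joinl_mor (id2 c) = idm (joinl_ob c).
Proof.
rewrite /joinl_mor clast2_id cinit2_id mmor1.
by rewrite (@mmor1 K C E p 0 G (mlast m) tt Y (clast c)) comp2_id.
Qed.

Lemma joinlM X (m : mids C n.+1) Y (c c' c'' : chain X m Y)
    (v : chain2 c' c'') (u : chain2 c c') :
  joinl_mor (vcomp2 v u) = joinl_mor v \vo joinl_mor u.
Proof.
rewrite /joinl_mor clast2_vcomp cinit2_vcomp mmorM -comp2_vcomp.
by rewrite -(@mmorM K C E p 0 G (mlast m) tt Y).
Qed.

Lemma joinl_lin X (m : mids C n.+1) Y (c c' : chain X m Y) :
  multilinear (@joinl_mor X m Y c c').
Proof.
apply: (multilinear_init_last (@bilinear_comp2 K E _ _ _ _ _ _ _)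
  (@mmor_lin K C E p n H _ _ _ (cinit c) (cinit c'))).
exact: (@mmor_lin K C E p 0 G (mlast m) tt Y).
Qed.

Definition joinl : multifun p n.+1 := MultiFun joinl1 joinlM joinl_lin.

End JoinLast.

(* H o (id x ... x c^C x ... x id) *)
Section Contract.
Variables (n i : nat) (H : multifun p n).

Lemma contract1 X (m : mids C n.+1) Y (c : chain X m Y) :
  mmor H (ctr2 i (id2 c)) = idm (mob H (ctr i c)).
Proof. by rewrite ctr2_id mmor1. Qed.

Lemma contractM X (m : mids C n.+1) Y (c c' c'' : chain X m Y)
    (v : chain2 c' c'') (u : chain2 c c') :
  mmor H (ctr2 i (vcomp2 v u)) = mmor H (ctr2 i v) \vo mmor H (ctr2 i u).
Proof. by rewrite ctr2_vcomp mmorM. Qed.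

Lemma contract_lin X (m : mids C n.+1) Y (c c' : chain X m Y) :
  multilinear (fun a : chain2 c c' => mmor H (ctr2 i a)).
Proof. by apply: multilinear_ctr; apply: mmor_lin. Qed.

Definition contract : multifun p n.+1 :=
  MultiFun contract1 contractM contract_lin.

End Contract.

Record itnat n (H H' : multifun p n) := ItNat {
  itn :> forall X (m : mids C n) Y (c : chain X m Y), hom (mob H c) (mob H' c);
  itn_nat : forall X (m : mids C n) Y (c c' : chain X m Y) (a : chain2 c c'),
    itn c' \vo mmor H a = mmor H' a \vo itn c }.

Arguments itn {n H H'} _ {X m Y} c.

Lemma itnat_ext n (H H' : multifun p n) (s t : itnat H H') :
  (forall X (m : mids C n) Y (c : chain X m Y), itn s c = itn t c) -> s = t.
Proof.
case: s t => [s sn] [t tn] /= est.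
have e : s = t by do 4! apply: functional_extensionality_dep => ?.
by case: t / e tn est => tn _; congr ItNat; apply: Prop_irrelevance.
Qed.

Section ItNatModule.
Variables (n : nat) (H H' : multifun p n).
Implicit Types s t : itnat H H'.

HB.instance Definition _ := gen_eqMixin (itnat H H').
HB.instance Definition _ := gen_choiceMixin (itnat H H').

Lemma itnat0_nat X (m : mids C n) Y (c c' : chain X m Y) (a : chain2 c c') :
  0 \vo mmor H a = mmor H' a \vo 0.
Proof. by rewrite vcomp0l vcomp0r. Qed.

Definition itnat0 : itnat H H' := ItNat itnat0_nat.

Lemma itnat_opp_nat t X (m : mids C n) Y (c c' : chain X m Y)
    (a : chain2 c c') :
  (- itn t c') \vo mmor H a = mmor H' a \vo (- itn t c).
Proof.
by rewrite -scaleN1r -[- itn t c]scaleN1r vcompZl vcompZr itn_nat.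
Qed.

Definition itnat_opp t : itnat H H' := ItNat (itnat_opp_nat t).

Lemma itnat_add_nat s t X (m : mids C n) Y (c c' : chain X m Y)
    (a : chain2 c c') :
  (itn s c' + itn t c') \vo mmor H a = mmor H' a \vo (itn s c + itn t c).
Proof. by rewrite vcompDl vcompDr !itn_nat. Qed.

Definition itnat_add s t : itnat H H' := ItNat (itnat_add_nat s t).

Lemma itnat_scale_nat (x : K) t X (m : mids C n) Y (c c' : chain X m Y)
    (a : chain2 c c') :
  (x *: itn t c') \vo mmor H a = mmor H' a \vo (x *: itn t c).
Proof. by rewrite vcompZl vcompZr itn_nat. Qed.

Definition itnat_scale x t : itnat H H' := ItNat (itnat_scale_nat x t).

Lemma itnat_addA : associative itnat_add.
Proof. by move=> r s t; apply: itnat_ext => *; apply: addrA. Qed.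
Lemma itnat_addC : commutative itnat_add.
Proof. by move=> s t; apply: itnat_ext => *; apply: addrC. Qed.
Lemma itnat_add0 : left_id itnat0 itnat_add.
Proof. by move=> t; apply: itnat_ext => *; apply: add0r. Qed.
Lemma itnat_addN : left_inverse itnat0 itnat_opp itnat_add.
Proof. by move=> t; apply: itnat_ext => *; apply: addNr. Qed.

HB.instance Definition _ := GRing.isZmodule.Build (itnat H H')
  itnat_addA itnat_addC itnat_add0 itnat_addN.

Lemma itnat_scaleA x y t :
  itnat_scale x (itnat_scale y t) = itnat_scale (x * y) t.
Proof. by apply: itnat_ext => *; apply: scalerA. Qed.
Lemma itnat_scale1 : left_id 1 itnat_scale.
Proof. by move=> t; apply: itnat_ext => *; apply: scale1r. Qed.
Lemma itnat_scaleDr : right_distributive itnat_scale +%R.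
Proof. by move=> x s t; apply: itnat_ext => *; apply: scalerDr. Qed.
Lemma itnat_scaleDl t : {morph itnat_scale^~ t : x y / x + y}.
Proof. by move=> x y; apply: itnat_ext => *; apply: scalerDl. Qed.

HB.instance Definition _ := GRing.Zmodule_isLmodule.Build K (itnat H H')
  itnat_scaleA itnat_scale1 itnat_scaleDr itnat_scaleDl.

End ItNatModule.

Lemma itnat_id_nat n (H : multifun p n) X (m : mids C n) Y
    (c c' : chain X m Y) (a : chain2 c c') :
  idm (mob H c') \vo mmor H a = mmor H a \vo idm (mob H c).
Proof. by rewrite vcomp1l vcomp1r. Qed.

Definition itnat_id n (H : multifun p n) : itnat H H := ItNat (@itnat_id_nat n H).

Lemma itnat_vcomp_nat n (H H' H'' : multifun p n) (t : itnat H' H'')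
    (s : itnat H H') X (m : mids C n) Y (c c' : chain X m Y)
    (a : chain2 c c') :
  (itn t c' \vo itn s c') \vo mmor H a = mmor H'' a \vo (itn t c \vo itn s c).
Proof. by rewrite -vcompA itn_nat vcompA itn_nat vcompA. Qed.

Definition itnat_vcomp n (H H' H'' : multifun p n) (t : itnat H' H'')
  (s : itnat H H') : itnat H H'' := ItNat (itnat_vcomp_nat t s).

End MultiFunOps.

Arguments itn {K C E p n H H'} _ {X m Y} c.

(* A composition (i_1, ..., i_r) of n.+1: [blk n] is (n.+1), and [bcons k I] is
   (k.+1) followed by I. *)
Inductive blocks : nat -> Type :=
| blk n : blocks n
| bcons k n : blocks n -> blocks (k + n.+1).

Section Iterates.
Variables (K : fieldType) (C D : twocat K) (F : pseudofunctor C D).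

Fixpoint compall (n : nat) :
    forall (X : C) (m : mids C n) (Y : C), chain X m Y -> cell1 C X Y :=
  match n return forall (X : C) (m : mids C n) (Y : C),
      chain X m Y -> cell1 C X Y with
  | 0 => fun X m Y c => c
  | n'.+1 => fun X m Y c => compall c.2 \co c.1
  end.

Fixpoint compall2 (n : nat) :
    forall (X : C) (m : mids C n) (Y : C) (c c' : chain X m Y),
      chain2 c c' -> hom (compall c) (compall c') :=
  match n return forall (X : C) (m : mids C n) (Y : C) (c c' : chain X m Y),
      chain2 c c' -> hom (compall c) (compall c') with
  | 0 => fun X m Y c c' a => a
  | n'.+1 => fun X m Y c c' a => compall2 a.2 \ho a.1
  end.

Lemma compall2_id n X (m : mids C n) Y (c : chain X m Y) :
  compall2 (id2 c) = idm (compall c).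
Proof. by elim: n X m c => [|n IH] X m c //=; rewrite IH comp2_id. Qed.

Lemma compall2_vcomp n X (m : mids C n) Y (c c' c'' : chain X m Y)
    (v : chain2 c' c'') (u : chain2 c c') :
  compall2 (vcomp2 v u) = compall2 v \vo compall2 u.
Proof.
elim: n X m c c' c'' v u => [|n IH] X m c c' c'' v u //=.
by rewrite IH comp2_vcomp.
Qed.

Lemma compall2_lin n X (m : mids C n) Y (c c' : chain X m Y) :
  multilinear (@compall2 n X m Y c c').
Proof.
elim: n X m c c' => [|n IH] X m c c' //=.
split=> [b t u v|a]; first by rewrite comp2_linr.
exact: (multilinear_linear (comp2_linl a) (IH _ _ _ _)).
Qed.

Lemma block1 n X (m : mids C n) Y (c : chain X m Y) :
  fmor (pfun F) (compall2 (id2 c)) = idm (pfun F (compall c)).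
Proof. by rewrite compall2_id fmor1. Qed.

Lemma blockM n X (m : mids C n) Y (c c' c'' : chain X m Y)
    (v : chain2 c' c'') (u : chain2 c c') :
  fmor (pfun F) (compall2 (vcomp2 v u)) =
  fmor (pfun F) (compall2 v) \vo fmor (pfun F) (compall2 u).
Proof. by rewrite compall2_vcomp fmorM. Qed.

Lemma block_lin n X (m : mids C n) Y (c c' : chain X m Y) :
  multilinear (fun a : chain2 c c' => fmor (pfun F) (compall2 a)).
Proof.
exact: (multilinear_linear (@fmor_lin _ _ _ (pfun F) _ _) (@compall2_lin _ _ _ _ _ _)).
Qed.

Definition block n : multifun F n :=
  MultiFun (@block1 n) (@blockM n) (@block_lin n).

(* F^{(i_1, ..., i_r)}: compose within each block, apply F, compose in D *)
Fixpoint iterate n (I : blocks n) : multifun F n :=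
  match I in blocks n return multifun F n with
  | blk n => block n
  | bcons k n I' => join (block k) (iterate I')
  end.

Definition is_iterate n (H : multifun F n) := exists I : blocks n, H = iterate I.

Record iter_ob n := IterOb {
  iter_fun :> multifun F n;
  iterP : is_iterate iter_fun }.

End Iterates.

Section StringIdentities.
Variables (K : fieldType) (C : twocat K).

(* Equations between morphisms of strings hold only up to equations between
   their intermediate objects, whence the packages. *)
Let cells n (X Y : C) :=
  {m : mids C n & {c : chain X m Y & {c' : chain X m Y & chain2 c c'}}}.

Definition pack n (X : C) (m : mids C n) (Y : C) (c c' : chain X m Y)
    (a : chain2 c c') : cells n X Y :=
  existT _ m (existT _ c (existT _ c' a)).

Definition pack_last n (X Z : C) (m : mids C n) (c c' : chain X m Z) (Y : C)
    (f f' : cell1 C Z Y) (a : chain2 c c') (u : hom f f') :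
    {Z : C & (cells n X Z *
      {f : cell1 C Z Y & {f' : cell1 C Z Y & hom f f'}})%type} :=
  existT _ Z (pack a, arr u).

Let pcons n (X Z Y : C) (f f' : cell1 C X Z) (u : hom f f') (z : cells n Z Y) :
    cells n.+1 X Y :=
  @pack n.+1 X (Z, projT1 z) Y (f, projT1 (projT2 z))
    (f', projT1 (projT2 (projT2 z))) (u, projT2 (projT2 (projT2 z))).

Lemma pack_cons n (X Z Y : C) (f f' : cell1 C X Z) (u : hom f f')
    (m m' : mids C n) (c d : chain Z m Y) (c' d' : chain Z m' Y)
    (a : chain2 c d) (a' : chain2 c' d') :
  pack a = pack a' ->
  @pack n.+1 X (Z, m) Y (f, c) (f', d) (u, a) =
  @pack n.+1 X (Z, m') Y (f, c') (f', d') (u, a').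
Proof. exact: (f_equal (pcons u)). Qed.

Lemma pack_comp2A n (X Z W Y : C) (m : mids C n.+1) (f f' : cell1 C X Z)
    (g g' : cell1 C Z W) (h h' : cell1 C W m.1) (c d : chain m.1 m.2 Y)
    (u : hom f f') (v : hom g g') (w : hom h h') (a : chain2 c d) :
  @pack n.+1 X m Y (h \co g \co f, c) (h' \co g' \co f', d)
    (w \ho v \ho u, a) =
  @pack n.+1 X m Y (h \co (g \co f), c) (h' \co (g' \co f'), d)
    (w \ho (v \ho u), a).
Proof.
pose G (z : {x : cell1 C X m.1 & {y : cell1 C X m.1 & hom x y}}) :=
  @pack n.+1 X m Y (projT1 z, c) (projT1 (projT2 z), d)
    (projT2 (projT2 z), a).
exact: esym (f_equal G (comp2A w v u)).
Qed.

Lemma pack_comp2A0 (X Z W Y : C) (m : mids C 0) (f f' : cell1 C X Z)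
    (g g' : cell1 C Z W) (h h' : cell1 C W Y)
    (u : hom f f') (v : hom g g') (w : hom h h') :
  @pack 0 X m Y (h \co g \co f) (h' \co g' \co f') (w \ho v \ho u) =
  @pack 0 X m Y (h \co (g \co f)) (h' \co (g' \co f')) (w \ho (v \ho u)).
Proof.
pose G (z : {x : cell1 C X Y & {y : cell1 C X Y & hom x y}}) :=
  @pack 0 X m Y (projT1 z) (projT1 (projT2 z)) (projT2 (projT2 z)).
exact: esym (f_equal G (comp2A w v u)).
Qed.

Lemma pack_ctr n i j X (m : mids C n.+2) Y (c c' : chain X m Y)
    (a : chain2 c c') : (i <= j)%N -> (j <= n)%N ->
  pack (ctr2 i (ctr2 j.+1 a)) = pack (ctr2 j (ctr2 i a)).
Proof.
elim: n i j X m c c' a => [|n IH] [|i] [|j] X m c c' a //.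
- move=> _ _; exact: (pack_comp2A0 _ a.1 a.2.1 a.2.2).
- move=> _ _; exact: (pack_comp2A a.1 a.2.1 a.2.2.1 a.2.2.2).
rewrite !ltnS => le_ij le_jn.
exact: pack_cons (IH i j _ _ _ _ a.2 le_ij le_jn).
Qed.

Lemma pack_last_ctr n i X (m : mids C n.+2) Y (c c' : chain X m Y)
    (a : chain2 c c') : (i <= n)%N ->
  pack_last (cinit2 (ctr2 i a)) (clast2 (ctr2 i a)) =
  pack_last (ctr2 i (cinit2 a)) (clast2 a).
Proof.
elim: n i X m c c' a => [|n IH] [|i] X m c c' a //=.
rewrite ltnS => le_in.
pose G (z : {Z : C & (cells n m.1 Z *
    {f : cell1 C Z Y & {f' : cell1 C Z Y & hom f f'}})%type}) :=
  existT (fun Z => (cells n.+1 X Z *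
    {f : cell1 C Z Y & {f' : cell1 C Z Y & hom f f'}})%type)
    (projT1 z) (pcons a.1 (projT2 z).1, (projT2 z).2).
exact: (f_equal G (IH i _ _ _ _ a.2 le_in)).
Qed.

Lemma pack_last_ctr_last n X (m : mids C n.+2) Y (c c' : chain X m Y)
    (a : chain2 c c') :
  pack_last (cinit2 (ctr2 n.+1 a)) (clast2 (ctr2 n.+1 a)) =
  pack_last (cinit2 (cinit2 a)) (clast2 a \ho clast2 (cinit2 a)).
Proof.
elim: n X m c c' a => [|n IH] X m c c' a //=.
pose G (z : {Z : C & (cells n m.1 Z *
    {f : cell1 C Z Y & {f' : cell1 C Z Y & hom f f'}})%type}) :=
  existT (fun Z => (cells n.+1 X Z *
    {f : cell1 C Z Y & {f' : cell1 C Z Y & hom f f'}})%type)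
    (projT1 z) (pcons a.1 (projT2 z).1, (projT2 z).2).
exact: (f_equal G (IH _ _ _ _ a.2)).
Qed.

Lemma pack_ctr_big n i X (m : mids C n.+1) Y (c c' : chain X m Y)
    (a : chain2 c c') : (n <= i)%N -> pack (ctr2 i a) = pack (ctr2 n a).
Proof.
elim: n i X m c c' a => [|n IH] [|i] X m c c' a //=.
rewrite ltnS => le_ni; exact: pack_cons (IH i _ _ _ _ a.2 le_ni).
Qed.

Lemma compall2_ctr n i X (m : mids C n.+1) Y (c c' : chain X m Y)
    (a : chain2 c c') : arr (compall2 (ctr2 i a)) = arr (compall2 a).
Proof.
elim: n i X m c c' a => [|n IH] [|i] X m c c' a //=; first exact: comp2A.
by apply: arr_comp2 => //; apply: IH.
Qed.

Lemma compall_ctr n i X (m : mids C n.+1) Y (c : chain X m Y) :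
  compall (ctr i c) = compall c.
Proof. exact: arr_src (compall2_ctr i (id2 c)). Qed.

Lemma compall2_last n X (m : mids C n.+1) Y (c c' : chain X m Y)
    (a : chain2 c c') :
  arr (clast2 a \ho compall2 (cinit2 a)) = arr (compall2 a).
Proof.
elim: n X m c c' a => [|n IH] X m c c' a //=.
by rewrite comp2A; apply: arr_comp2.
Qed.

Lemma compall_last n X (m : mids C n.+1) Y (c : chain X m Y) :
  clast c \co compall (cinit c) = compall c.
Proof. exact: arr_src (compall2_last (id2 c)). Qed.

Variables (D : twocat K) (p : C -> D).

(* The diagonal of the naturality square of s at a *)
Definition diag n (H H' : multifun p n) (s : itnat H H') (X : C)
    (m : mids C n) (Y : C) (c c' : chain X m Y) (a : chain2 c c') :
    hom (mob H c) (mob H' c') :=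
  mmor H' a \vo itn s c.

Lemma diag_id n (H : multifun p n) (X : C)
    (m : mids C n) (Y : C) (c c' : chain X m Y) (a : chain2 c c') :
  diag (itnat_id H) a = mmor H a.
Proof. exact: vcomp1r. Qed.

Lemma diag_id2 n (H H' : multifun p n) (s : itnat H H') (X : C)
    (m : mids C n) (Y : C) (c : chain X m Y) : diag s (id2 c) = itn s c.
Proof. by rewrite /diag mmor1 vcomp1l. Qed.

Lemma diag_pack n (H H' : multifun p n) (s : itnat H H') (X Y : C)
    (m m' : mids C n) (c d : chain X m Y) (c' d' : chain X m' Y)
    (a : chain2 c d) (a' : chain2 c' d') :
  pack a = pack a' -> arr (diag s a) = arr (diag s a').
Proof.
pose G (z : cells n X Y) := arr (diag s (projT2 (projT2 (projT2 z)))).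
exact: (f_equal G).
Qed.

End StringIdentities.

Section IterCat.
Variables (K : fieldType) (C D : twocat K) (F : pseudofunctor C D).

Section Cat.
Variable n : nat.
Implicit Types H : iter_ob F n.

Let ihom H H' : lmodType K := itnat H H'.

Let ivcomp1l H H' (u : ihom H H') : itnat_vcomp (itnat_id H') u = u.
Proof. by apply: itnat_ext => *; apply: vcomp1l. Qed.

Let ivcomp1r H H' (u : ihom H H') : itnat_vcomp u (itnat_id H) = u.
Proof. by apply: itnat_ext => *; apply: vcomp1r. Qed.

Let ivcompA H1 H2 H3 H4 (w : ihom H3 H4) (v : ihom H2 H3) (u : ihom H1 H2) :
  itnat_vcomp w (itnat_vcomp v u) = itnat_vcomp (itnat_vcomp w v) u.
Proof. by apply: itnat_ext => *; apply: vcompA. Qed.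

Let ivcomp_linl H1 H2 H3 (u : ihom H1 H2) :
  linear (fun v : ihom H2 H3 => itnat_vcomp v u : ihom H1 H3).
Proof. by move=> a v w; apply: itnat_ext => *; apply: vcomp_linl. Qed.

Let ivcomp_linr H1 H2 H3 (v : ihom H2 H3) :
  linear (fun u : ihom H1 H2 => itnat_vcomp v u : ihom H1 H3).
Proof. by move=> a u w; apply: itnat_ext => *; apply: vcomp_linr. Qed.

Definition itercat : lincat K :=
  @LinCat K (iter_ob F n) ihom (fun H => itnat_id H)
    (fun _ _ _ v u => itnat_vcomp v u) ivcomp1l ivcomp1r ivcompA
    ivcomp_linl ivcomp_linr.

Lemma iter_ob_eq H H' : iter_fun H = iter_fun H' -> H = H'.
Proof.
case: H H' => [H HP] [H' HP'] /= e; case: H' / e HP' => HP'.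
by congr IterOb; apply: Prop_irrelevance.
Qed.

Lemma arr_itercat (G G' L L' : itercat) (s : hom G G') (t : hom L L') :
  G = L -> G' = L' ->
  (forall X (m : mids C n) Y (c : chain X m Y),
     arr (itn s c) = arr (itn t c)) ->
  arr s = arr t.
Proof.
move=> e e'; case: L / e t; case: L' / e' => t est.
congr arr; apply: itnat_ext => X m Y c; exact: arr_inj (est X m Y c).
Qed.

End Cat.

Lemma iter_functor_ext n n' (P Q : linfunctor (itercat n) (itercat n')) :
  (forall (H H' : itercat n) (s : hom H H') X (m : mids C n') Y
     (c c' : chain X m Y) (a : chain2 c c'),
     arr (diag (fmor P s) a) = arr (diag (fmor Q s) a)) ->
  P = Q.
Proof.
move=> E.
have eo H : P H = Q H.
  apply: iter_ob_eq; apply: multifun_ext => X m Y c c' a.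
  have := E H H (idm H) X m Y c c' a.
  by rewrite !fmor1 !diag_id.
apply: linfunctor_ext => H H' s; apply: arr_itercat => // X m Y c.
by have := E H H' s X m Y c c (id2 c); rewrite !diag_id2.
Qed.

Section MkIsom.
Variables (n : nat) (G G' : itercat n).
Variable t : forall X (m : mids C n) Y (c : chain X m Y),
  isom (mob G c) (mob G' c).
Hypothesis tnat : forall X (m : mids C n) Y (c c' : chain X m Y)
  (a : chain2 c c'), t c' \vo mmor G a = mmor G' a \vo t c.

Lemma mk_isom_bwd_nat X (m : mids C n) Y (c c' : chain X m Y)
    (a : chain2 c c') :
  bwd (t c') \vo mmor G' a = mmor G a \vo bwd (t c).
Proof.
rewrite -[LHS]vcomp1r -(fwdK (t c)) vcompA -(vcompA (bwd (t c'))).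
by rewrite -tnat vcompA bwdK vcomp1l.
Qed.

Let mk_fwd : @hom K (itercat n) G G' := ItNat tnat.
Let mk_bwd : @hom K (itercat n) G' G := ItNat mk_isom_bwd_nat.

Lemma mk_isom_bwdK : mk_bwd \vo mk_fwd = idm G.
Proof. by apply: itnat_ext => X m Y c; apply: bwdK. Qed.

Lemma mk_isom_fwdK : mk_fwd \vo mk_bwd = idm G'.
Proof. by apply: itnat_ext => X m Y c; apply: fwdK. Qed.

Definition mk_isom : isom G G' := Isom mk_isom_bwdK mk_isom_fwdK.

End MkIsom.

Section MkNatIso.
Variables (n n' : nat) (P Q : linfunctor (itercat n) (itercat n')).
Variable t : forall (H : itercat n) X (m : mids C n') Y (c : chain X m Y),
  isom (mob (P H) c) (mob (Q H) c).
Hypothesis tnat : forall (H H' : itercat n) (s : hom H H') X (m : mids C n') Y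
  (c c' : chain X m Y) (a : chain2 c c'),
  t H' c' \vo diag (fmor P s) a = diag (fmor Q s) a \vo t H c.

Lemma mk_natiso_itnat (H : itercat n) X (m : mids C n') Y (c c' : chain X m Y)
    (a : chain2 c c') :
  t H c' \vo mmor (P H) a = mmor (Q H) a \vo t H c.
Proof. by have := tnat (idm H) a; rewrite !fmor1 !diag_id. Qed.

Lemma mk_natiso_nat (H H' : itercat n) (s : hom H H') :
  mk_isom (@mk_natiso_itnat H') \vo fmor P s =
  fmor Q s \vo mk_isom (@mk_natiso_itnat H).
Proof.
apply: itnat_ext => X m Y c /=.
by have := tnat s (id2 c); rewrite !diag_id2.
Qed.

Definition mk_natiso : natiso P Q := NatIso mk_natiso_nat.

End MkNatIso.

Definition front_ob n (H : multifun F n) : multifun F n.+1 :=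
  join (block F 0) H.
Definition last_ob n (H : multifun F n) : multifun F n.+1 :=
  joinl H (block F 0).
Definition ctr_ob n (i : nat) (H : multifun F n) : multifun F n.+1 :=
  contract i H.

Lemma ctr_front n i (H : multifun F n) :
  ctr_ob i.+1 (front_ob H) = front_ob (ctr_ob i H).
Proof. exact: multifun_ext. Qed.

Lemma last_front n (H : multifun F n) :
  last_ob (front_ob H) = front_ob (last_ob H).
Proof. by apply: multifun_ext => X m Y c c' a; apply: comp2A. Qed.

Lemma ctr_ctr n i j (H : multifun F n) : (i <= j)%N -> (j <= n)%N ->
  ctr_ob j.+1 (ctr_ob i H) = ctr_ob i (ctr_ob j H).
Proof.
move=> le_ij le_jn; apply: multifun_ext => X m Y c c' a.
rewrite /= -[mmor H _]diag_id -[in RHS]diag_id.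
exact: diag_pack (pack_ctr a le_ij le_jn).
Qed.

Lemma ctr_big n i (H : multifun F n) : (n <= i)%N ->
  ctr_ob i H = ctr_ob n H.
Proof.
move=> le_ni; apply: multifun_ext => X m Y c c' a.
rewrite /= -[mmor H _]diag_id -[in RHS]diag_id.
exact: diag_pack (pack_ctr_big a le_ni).
Qed.

Lemma diag_pack_last n (H H' : multifun F n) (s : itnat H H') (X Y Z Z' : C)
    (m m' : mids C n) (c d : chain X m Z) (c' d' : chain X m' Z')
    (a : chain2 c d) (a' : chain2 c' d')
    (f g : cell1 C Z Y) (f' g' : cell1 C Z' Y) (u : hom f g) (u' : hom f' g') :
  pack_last a u = pack_last a' u' ->
  arr (fmor (pfun F) u \ho diag s a) = arr (fmor (pfun F) u' \ho diag s a').
Proof.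
pose G (z : {Z : C & ({m : mids C n & {c : chain X m Z &
    {c' : chain X m Z & chain2 c c'}}} *
    {f : cell1 C Z Y & {f' : cell1 C Z Y & hom f f'}})%type}) :=
  arr (fmor (pfun F) (projT2 (projT2 (projT2 z).2)) \ho
       diag s (projT2 (projT2 (projT2 (projT2 z).1)))).
exact: (f_equal G).
Qed.

Lemma last_ctr n i (H : multifun F n) : (i <= n)%N ->
  last_ob (ctr_ob i H) = ctr_ob i (last_ob H).
Proof.
move=> le_in; apply: multifun_ext => X m Y c c' a.
rewrite /= /joinl_mor /= -[mmor H _]diag_id -[mmor H (cinit2 _)]diag_id.
exact: esym (diag_pack_last _ (pack_last_ctr a le_in)).
Qed.

Lemma ctr_block n : ctr_ob 0 (block F n) = block F n.+1.
Proof.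
apply: multifun_ext => X m Y c c' a.
exact: arr_fmor (compall2_ctr 0 a).
Qed.

Lemma ctr_join k n (H : multifun F n) :
  ctr_ob 0 (join (block F k) H) = join (block F k.+1) H.
Proof.
apply: multifun_ext; case: k => [|k] X m Y c c' a //.
rewrite /= /join_mor /=; apply: arr_comp2 => //.
exact: arr_fmor (comp2A (compall2 (ctake2 a.2.2)) a.2.1 a.1).
Qed.

Inductive generated : forall n, multifun F n -> Prop :=
| gen_block : generated (block F 0)
| gen_front n (H : multifun F n) : generated H -> generated (front_ob H)
| gen_ctr n (H : multifun F n) : generated H -> generated (ctr_ob 0 H).

Lemma generatedP n (H : multifun F n) : generated H <-> is_iterate H.
Proof.
split=> [|[I {H}->]].
  elim=> {n H} [|n H _ [I ->]|n H _ [I ->]]; first by exists (blk 0).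
    by exists (bcons 0 I).
  case: n / I H => [n|k n I] _; first by exists (blk n.+1); apply: ctr_block.
  by exists (bcons k.+1 I); apply: ctr_join.
elim: n / I => [n|k n I gI] /=.
  elim: n => [|n IH]; first exact: gen_block.
  by rewrite -ctr_block; apply: gen_ctr.
elim: k => [|k IH]; first exact: gen_front.
by rewrite -ctr_join; apply: gen_ctr.
Qed.

Lemma front_iterP n (H : itercat n) : is_iterate (front_ob H).
Proof. by apply/generatedP/gen_front/generatedP/iterP. Qed.

Lemma ctr_iterP n i (H : itercat n) : is_iterate (ctr_ob i H).
Proof.
apply/generatedP; have /generatedP := iterP H; move: (iter_fun H) => {}H gH.
elim: gH i => {n H} [|n H gH IH|n H gH IH] i.
- by rewrite ctr_big //; apply: gen_ctr gen_block.
- case: i => [|i]; first exact/gen_ctr/gen_front.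
  by rewrite ctr_front; apply/gen_front/IH.
case: i => [|i]; first exact/gen_ctr/gen_ctr.
case: (leqP i n) => [le_in|/ltnW lt_ni]; first by rewrite ctr_ctr //; apply/gen_ctr/IH.
by rewrite ctr_big // ctr_ctr //; apply/gen_ctr/IH.
Qed.


Lemma last_iterP n (H : itercat n) : is_iterate (last_ob H).
Proof.
apply/generatedP; have /generatedP := iterP H; move: (iter_fun H) => {}H gH.
elim: gH => {n H} [|n H gH IH|n H gH IH].
- suff -> : last_ob (block F 0) = front_ob (block F 0).
    exact: gen_front gen_block.
  exact: multifun_ext.
- by rewrite last_front; apply: gen_front.
by rewrite last_ctr //; apply: gen_ctr.
Qed.

Section Faces.
Variable n : nat.
Implicit Types H : itercat n.

Definition front_iter H : itercat n.+1 := IterOb (front_iterP H).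
Definition ctr_iter i H : itercat n.+1 := IterOb (ctr_iterP i H).
Definition last_iter H : itercat n.+1 := IterOb (last_iterP H).

Section OnMorphisms.
Variables (H H' : itercat n) (s : @hom K (itercat n) H H').

Lemma front_nat X (m : mids C n.+1) Y (c c' : chain X m Y) (a : chain2 c c') :
  (itn s c'.2 \ho idm (pfun F c'.1)) \vo mmor (front_iter H) a =
  mmor (front_iter H') a \vo (itn s c.2 \ho idm (pfun F c.1)).
Proof. by rewrite -!comp2_vcomp vcomp1l vcomp1r itn_nat. Qed.

Definition front_mor : @hom K (itercat n.+1) (front_iter H) (front_iter H') :=
  @ItNat K C D F n.+1 (front_iter H) (front_iter H')
    (fun X m Y (c : @chain K C n.+1 X m Y) =>
       itn s c.2 \ho idm (pfun F c.1)) front_nat.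

Lemma ctr_nat i X (m : mids C n.+1) Y (c c' : chain X m Y)
    (a : chain2 c c') :
  itn s (ctr i c') \vo mmor (ctr_iter i H) a =
  mmor (ctr_iter i H') a \vo itn s (ctr i c).
Proof. exact: (itn_nat s (ctr2 i a)). Qed.

Definition ctr_mor i : @hom K (itercat n.+1) (ctr_iter i H) (ctr_iter i H') :=
  @ItNat K C D F n.+1 (ctr_iter i H) (ctr_iter i H')
    (fun X m Y (c : @chain K C n.+1 X m Y) => itn s (ctr i c)) (@ctr_nat i).

Lemma last_nat X (m : mids C n.+1) Y (c c' : chain X m Y) (a : chain2 c c') :
  (idm (pfun F (clast c')) \ho itn s (cinit c')) \vo mmor (last_iter H) a =
  mmor (last_iter H') a \vo (idm (pfun F (clast c)) \ho itn s (cinit c)).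
Proof. by rewrite -!comp2_vcomp vcomp1l vcomp1r itn_nat. Qed.

Definition last_mor : @hom K (itercat n.+1) (last_iter H) (last_iter H') :=
  @ItNat K C D F n.+1 (last_iter H) (last_iter H')
    (fun X m Y (c : @chain K C n.+1 X m Y) =>
       idm (pfun F (clast c)) \ho itn s (cinit c)) last_nat.

End OnMorphisms.

Lemma front_1 H : front_mor (idm H) = idm (front_iter H).
Proof. by apply: itnat_ext => X m Y c; apply: comp2_id. Qed.

Lemma front_M (H1 H2 H3 : itercat n) (t : hom H2 H3) (s : hom H1 H2) :
  front_mor (t \vo s) = front_mor t \vo front_mor s.
Proof.
by apply: itnat_ext => X m Y c /=; rewrite -comp2_vcomp vcomp1l.
Qed.

Lemma front_lin (H H' : itercat n) :
  linear (@front_mor H H' : hom H H' -> hom (front_iter H) (front_iter H')).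
Proof. by move=> x s t; apply: itnat_ext => X m Y c; apply: comp2_linl. Qed.

Definition frontF : linfunctor (itercat n) (itercat n.+1) :=
  LinFunctor front_1 front_M front_lin.

Lemma ctr_1 i H : ctr_mor (idm H) i = idm (ctr_iter i H).
Proof. exact: itnat_ext. Qed.

Lemma ctr_M i (H1 H2 H3 : itercat n) (t : hom H2 H3) (s : hom H1 H2) :
  ctr_mor (t \vo s) i = ctr_mor t i \vo ctr_mor s i.
Proof. exact: itnat_ext. Qed.

Lemma ctr_lin i (H H' : itercat n) :
  linear ((fun s => ctr_mor s i) :
    hom H H' -> hom (ctr_iter i H) (ctr_iter i H')).
Proof. by move=> x s t; apply: itnat_ext. Qed.

Definition ctrF i : linfunctor (itercat n) (itercat n.+1) :=
  LinFunctor (ctr_1 i) (ctr_M i) (@ctr_lin i).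

Lemma last_1 H : last_mor (idm H) = idm (last_iter H).
Proof. by apply: itnat_ext => X m Y c; apply: comp2_id. Qed.

Lemma last_M (H1 H2 H3 : itercat n) (t : hom H2 H3) (s : hom H1 H2) :
  last_mor (t \vo s) = last_mor t \vo last_mor s.
Proof.
by apply: itnat_ext => X m Y c /=; rewrite -comp2_vcomp vcomp1l.
Qed.

Lemma last_lin (H H' : itercat n) :
  linear (@last_mor H H' : hom H H' -> hom (last_iter H) (last_iter H')).
Proof. by move=> x s t; apply: itnat_ext => X m Y c; apply: comp2_linr. Qed.

Definition lastF : linfunctor (itercat n) (itercat n.+1) :=
  LinFunctor last_1 last_M last_lin.

(* O^i_{n+2}, meaningful for i <= n.+2 *)
Definition iter_face (i : nat) : linfunctor (itercat n) (itercat n.+1) :=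
  if i is i'.+1 then if (i' <= n)%N then ctrF i' else lastF else frontF.

Lemma diag_front (H H' : itercat n) (s : hom H H') X (m : mids C n.+1) Y
    (c c' : chain X m Y) (a : chain2 c c') :
  diag (fmor frontF s) a = diag s a.2 \ho fmor (pfun F) a.1.
Proof. by rewrite /diag /= -comp2_vcomp vcomp1r. Qed.

Lemma diag_last (H H' : itercat n) (s : hom H H') X (m : mids C n.+1) Y
    (c c' : chain X m Y) (a : chain2 c c') :
  diag (fmor lastF s) a = fmor (pfun F) (clast2 a) \ho diag s (cinit2 a).
Proof. by rewrite /diag /= -comp2_vcomp vcomp1r. Qed.

Lemma diag_ctr i (H H' : itercat n) (s : hom H H') X (m : mids C n.+1) Y
    (c c' : chain X m Y) (a : chain2 c c') :
  diag (fmor (ctrF i) s) a = diag s (ctr2 i a).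
Proof. by []. Qed.

End Faces.

Lemma ctrF_frontF n i :
  compF (ctrF n.+1 i.+1) (frontF n) = compF (frontF n.+1) (ctrF n i).
Proof.
apply: iter_functor_ext => H H' s X m Y c c' a.
rewrite (diag_ctr i.+1 (fmor (frontF n) s)) (diag_front (fmor (ctrF n i) s)).
by rewrite diag_ctr diag_front.
Qed.

Lemma lastF_frontF n :
  compF (lastF n.+1) (frontF n) = compF (frontF n.+1) (lastF n).
Proof.
apply: iter_functor_ext => H H' s X m Y c c' a.
rewrite (diag_last (fmor (frontF n) s)) (diag_front (fmor (lastF n) s)).
rewrite diag_last diag_front; exact: comp2A.
Qed.

Lemma ctrF_ctrF n i j : (i <= j)%N -> (j <= n)%N ->
  compF (ctrF n.+1 j.+1) (ctrF n i) = compF (ctrF n.+1 i) (ctrF n j).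
Proof.
move=> le_ij le_jn; apply: iter_functor_ext => H H' s X m Y c c' a.
exact: (diag_pack s (pack_ctr a le_ij le_jn)).
Qed.

Lemma lastF_ctrF n i : (i <= n)%N ->
  compF (lastF n.+1) (ctrF n i) = compF (ctrF n.+1 i) (lastF n).
Proof.
move=> le_in; apply: iter_functor_ext => H H' s X m Y c c' a.
rewrite (diag_last (fmor (ctrF n i) s)) (diag_ctr i (fmor (lastF n) s)).
rewrite diag_ctr diag_last.
exact: esym (diag_pack_last s (pack_last_ctr a le_in)).
Qed.

Lemma iter_face_comm n i j : (i <= j)%N -> (j <= n.+2)%N ->
  j <> 0 -> i <> n.+2 ->
  compF (iter_face n.+1 j.+1) (iter_face n i) =
  compF (iter_face n.+1 i) (iter_face n j).
Proof.
case: i j => [|i] [|j] // le_ij le_jn _ ne_in; rewrite /iter_face !ltnS.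
  case: leqP => [le_jn'|_]; first exact: ctrF_frontF.
  exact: lastF_frontF.
have le_in : (i <= n)%N.
  have : (i <= n.+1)%N := leq_trans le_ij le_jn.
  by rewrite leq_eqVlt => /predU1P[e|//]; case: ne_in; rewrite e.
rewrite le_in (leqW le_in).
by case: leqP => [le_jn'|_]; [apply: ctrF_ctrF | apply: lastF_ctrF].
Qed.

(* tau_{0,1}(H) = 1_c o (phat^{-1} x 1_H), followed by the identity between the
   two bracketings of its target *)
Section CohererFirst.
Variable n : nat.

Definition tau_first_at (H : itercat n) X (m : mids C n.+2) Y
    (c : chain X m Y) :
    isom (mob (ctr_iter 0 (front_iter H)) c)
         (mob (front_iter (front_iter H)) c) :=
  isom_comp
    (isom_idto (comp1A (mob H c.2.2) (pfun F c.2.1) (pfun F c.1)))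
    (isom_comp2 (isom_id (mob H c.2.2)) (isom_inv (phat F c.1 c.2.1))).

Lemma phat_bwd_nat (X Y Z : C) (f f' : cell1 C X Y) (g g' : cell1 C Y Z)
    (a : hom f f') (b : hom g g') :
  bwd (phat F f' g') \vo fmor (pfun F) (b \ho a) =
  (fmor (pfun F) b \ho fmor (pfun F) a) \vo bwd (phat F f g).
Proof.
rewrite -[LHS]vcomp1r -(fwdK (phat F f g)) vcompA.
rewrite -(vcompA (bwd (phat F f' g'))).
by rewrite -phat_nat vcompA bwdK vcomp1l.
Qed.

Lemma tau_first_nat (H H' : itercat n) (s : hom H H') X (m : mids C n.+2) Y
    (c c' : chain X m Y) (a : chain2 c c') :
  tau_first_at H' c' \vo diag (fmor (compF (ctrF n.+1 0) (frontF n)) s) a =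
  diag (fmor (compF (frontF n.+1) (frontF n)) s) a \vo tau_first_at H c.
Proof.
rewrite (diag_ctr 0 (fmor (frontF n) s)) (diag_front (fmor (frontF n) s)).
rewrite !diag_front /= -vcompA -comp2_vcomp vcomp1l phat_bwd_nat vcompA.
rewrite -(arr_idto (comp2A (diag s a.2.2) (fmor (pfun F) a.2.1)
  (fmor (pfun F) a.1)) (comp1A _ _ _) (comp1A _ _ _)).
by rewrite -vcompA -comp2_vcomp vcomp1r.
Qed.

Definition tau_first : natiso (compF (ctrF n.+1 0) (frontF n))
                              (compF (frontF n.+1) (frontF n)) :=
  @mk_natiso n n.+2 (compF (ctrF n.+1 0) (frontF n))
    (compF (frontF n.+1) (frontF n)) tau_first_at tau_first_nat.

End CohererFirst.

(* tau_{n,n+1}(H) = 1_c o (1_H x phat), between the identities that relate its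
   source and target to the definitional ones *)
Section CohererLast.
Variable n : nat.

Lemma ctr_last_ob (H : itercat n) X (m : mids C n.+2) Y (c : chain X m Y) :
  pfun F (clast c \co clast (cinit c)) \co mob H (cinit (cinit c)) =
  mob (ctr_iter n.+1 (last_iter H)) c.
Proof.
have := diag_pack_last (itnat_id H) (pack_last_ctr_last (id2 c)).
by move/arr_src.
Qed.

Definition tau_last_at (H : itercat n) X (m : mids C n.+2) Y
    (c : chain X m Y) :
    isom (mob (last_iter (last_iter H)) c)
         (mob (ctr_iter n.+1 (last_iter H)) c) :=
  isom_comp (isom_idto (ctr_last_ob H c))
  (isom_comp
    (isom_comp2 (phat F (clast (cinit c)) (clast c))
                (isom_id (mob H (cinit (cinit c)))))
    (isom_idto (comp1A (pfun F (clast c)) (pfun F (clast (cinit c)))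
                       (mob H (cinit (cinit c)))))).

Lemma tau_last_nat (H H' : itercat n) (s : hom H H') X (m : mids C n.+2) Y
    (c c' : chain X m Y) (a : chain2 c c') :
  tau_last_at H' c' \vo diag (fmor (compF (lastF n.+1) (lastF n)) s) a =
  diag (fmor (compF (ctrF n.+1 n.+1) (lastF n)) s) a \vo tau_last_at H c.
Proof.
rewrite (diag_last (fmor (lastF n) s)) (diag_ctr n.+1 (fmor (lastF n) s)).
rewrite !diag_last /= -!vcompA.
rewrite (arr_idto (comp2A (fmor (pfun F) (clast2 a))
  (fmor (pfun F) (clast2 (cinit2 a))) (diag s (cinit2 (cinit2 a)))) (comp1A _ _ _) (comp1A _ _ _)).
rewrite [X in _ \vo X = _]vcompA -comp2_vcomp phat_nat vcomp1l.
rewrite [RHS]vcompA.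
rewrite -(arr_idto (esym (diag_pack_last s (pack_last_ctr_last a)))
  (ctr_last_ob H c) (ctr_last_ob H' c')).
by rewrite -!vcompA; congr (_ \vo _); rewrite vcompA -comp2_vcomp vcomp1r.
Qed.

Definition tau_last : natiso (compF (lastF n.+1) (lastF n))
                             (compF (ctrF n.+1 n.+1) (lastF n)) :=
  @mk_natiso n n.+2 (compF (lastF n.+1) (lastF n))
    (compF (ctrF n.+1 n.+1) (lastF n)) tau_last_at tau_last_nat.

End CohererLast.

Section IterCoherer.
Variables (n i j : nat).
Hypotheses (le_ij : (i <= j)%N) (le_jn : (j <= n.+2)%N).

Lemma tau_first_src : j = 0 ->
  compF (ctrF n.+1 0) (frontF n) = compF (iter_face n.+1 j.+1) (iter_face n i).
Proof. by move=> j0; move: le_ij; rewrite j0 leqn0 => /eqP ->. Qed.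

Lemma tau_first_tgt : j = 0 ->
  compF (frontF n.+1) (frontF n) = compF (iter_face n.+1 i) (iter_face n j).
Proof. by move=> j0; move: le_ij; rewrite j0 leqn0 => /eqP ->. Qed.

Lemma tau_last_src : i = n.+2 ->
  compF (lastF n.+1) (lastF n) = compF (iter_face n.+1 j.+1) (iter_face n i).
Proof.
move=> ein; have -> : j = n.+2 by apply/eqP; rewrite eqn_leq le_jn -ein.
by rewrite ein /iter_face !ltnn.
Qed.

Lemma tau_last_tgt : i = n.+2 ->
  compF (ctrF n.+1 n.+1) (lastF n) =
  compF (iter_face n.+1 i) (iter_face n j).
Proof.
move=> ein; have -> : j = n.+2 by apply/eqP; rewrite eqn_leq le_jn -ein.
by rewrite ein /iter_face leqnn ltnn.
Qed.

Definition iter_coherer :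
    natiso (compF (iter_face n.+1 j.+1) (iter_face n i))
           (compF (iter_face n.+1 i) (iter_face n j)) :=
  match j =P 0%N, i =P n.+2 with
  | ReflectT j0, _ =>
      natiso_cast (tau_first_src j0) (tau_first_tgt j0) (tau_first n)
  | _, ReflectT ein =>
      natiso_cast (tau_last_src ein) (tau_last_tgt ein) (tau_last n)
  | ReflectF nj0, ReflectF nin =>
      idtoN (iter_face_comm le_ij le_jn nj0 nin)
  end.

End IterCoherer.

Definition iter1 : itercat 0 := IterOb (ex_intro _ (blk 0) erefl).

Definition tau0_first_at X (m : mids C 1) Y (c : chain X m Y) :
    isom (mob (ctr_iter 0 iter1) c) (mob (front_iter iter1) c) :=
  isom_inv (phat F c.1 c.2).

Lemma tau0_first_nat X (m : mids C 1) Y (c c' : chain X m Y)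
    (a : chain2 c c') :
  tau0_first_at c' \vo mmor (ctr_iter 0 iter1) a =
  mmor (front_iter iter1) a \vo tau0_first_at c.
Proof. exact: (phat_bwd_nat (a.1 : hom c.1 c'.1) (a.2 : hom c.2 c'.2)). Qed.

Definition tau0_last_at X (m : mids C 1) Y (c : chain X m Y) :
    isom (mob (last_iter iter1) c) (mob (ctr_iter 0 iter1) c) :=
  phat F c.1 c.2.

Lemma tau0_last_nat X (m : mids C 1) Y (c c' : chain X m Y)
    (a : chain2 c c') :
  tau0_last_at c' \vo mmor (last_iter iter1) a =
  mmor (ctr_iter 0 iter1) a \vo tau0_last_at c.
Proof. exact: (phat_nat F a.1 a.2). Qed.

Definition face0 : linfunctor (onecat K) (itercat 0) := pick_functor iter1.

Definition tau0_first :
    natiso (compF (ctrF 0 0) face0) (compF (frontF 0) face0) :=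
  @one_natiso K _ (compF (ctrF 0 0) face0) (compF (frontF 0) face0)
    (mk_isom tau0_first_nat).

Definition tau0_last :
    natiso (compF (lastF 0) face0) (compF (ctrF 0 0) face0) :=
  @one_natiso K _ (compF (lastF 0) face0) (compF (ctrF 0 0) face0)
    (mk_isom tau0_last_nat).

Lemma tau0_mid_eq : compF (lastF 0) face0 = compF (frontF 0) face0.
Proof.
apply: linfunctor_ext => -[] [] u; rewrite !one_fmor.
suff -> : compF (lastF 0) face0 tt = compF (frontF 0) face0 tt by [].
by apply: iter_ob_eq; apply: multifun_ext.
Qed.

Section IterCoherer0.
Variables (i j : nat).
Hypotheses (le_ij : (i <= j)%N) (le_j1 : (j <= 1)%N).

Lemma tau0_first_src : j = 0 ->
  compF (ctrF 0 0) face0 = compF (iter_face 0 j.+1) face0.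
Proof. by move=> ->. Qed.

Lemma tau0_first_tgt : j = 0 ->
  compF (frontF 0) face0 = compF (iter_face 0 i) face0.
Proof. by move=> j0; move: le_ij; rewrite j0 leqn0 => /eqP ->. Qed.

Lemma tau0_last_src : i = 1 ->
  compF (lastF 0) face0 = compF (iter_face 0 j.+1) face0.
Proof.
by move=> i1; have -> : j = 1 by apply/eqP; rewrite eqn_leq le_j1 -i1.
Qed.

Lemma tau0_last_tgt : i = 1 ->
  compF (ctrF 0 0) face0 = compF (iter_face 0 i) face0.
Proof. by move=> ->. Qed.

Lemma iter_face0_comm : j <> 0 -> i <> 1 ->
  compF (iter_face 0 j.+1) face0 = compF (iter_face 0 i) face0.
Proof.
move=> nj0 ni1; have -> : j = 1 by case: (j) le_j1 nj0 => [|[]].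
have -> : i = 0 by case: (i) (leq_trans le_ij le_j1) ni1 => [|[]].
exact: tau0_mid_eq.
Qed.

Definition iter_coherer0 :
    natiso (compF (iter_face 0 j.+1) face0) (compF (iter_face 0 i) face0) :=
  match j =P 0%N, i =P 1%N with
  | ReflectT j0, _ =>
      natiso_cast (tau0_first_src j0) (tau0_first_tgt j0) tau0_first
  | _, ReflectT i1 =>
      natiso_cast (tau0_last_src i1) (tau0_last_tgt i1) tau0_last
  | ReflectF nj0, ReflectF ni1 => idtoN (iter_face0_comm nj0 ni1)
  end.

End IterCoherer0.

Definition iter_cat (n : nat) : lincat K :=
  if n is n'.+1 then itercat n' else onecat K.

Definition iter_cosemi_face (n : nat) :
    'I_n.+2 -> linfunctor (iter_cat n) (iter_cat n.+1) :=
  match n return 'I_n.+2 -> linfunctor (iter_cat n) (iter_cat n.+1) with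
  | 0 => fun _ => face0
  | n'.+1 => fun i => iter_face n' i
  end.

Definition iter_cosemi_coherer (n : nat) :
    forall (i j : 'I_n.+2) (le_ij : (i <= j)%N),
    natiso (compF (iter_cosemi_face (lift ord0 j)) (iter_cosemi_face i))
           (compF (iter_cosemi_face (widen_ord (leqnSn n.+2) i))
                  (iter_cosemi_face j)) :=
  match n return forall (i j : 'I_n.+2) (le_ij : (i <= j)%N),
    natiso (compF (iter_cosemi_face (lift ord0 j)) (iter_cosemi_face i))
           (compF (iter_cosemi_face (widen_ord (leqnSn n.+2) i))
                  (iter_cosemi_face j)) with
  | 0 => fun i j le_ij => iter_coherer0 le_ij (ltn_ord j)
  | n'.+1 => fun i j le_ij => @iter_coherer n' i j le_ij (ltn_ord j)
  end.

Definition iter_cosemi : cosemi2 K :=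
  @Cosemi2 K iter_cat iter_cosemi_face iter_cosemi_coherer (idN face0).

Definition star : iter_cosemi 0 := tt.

Fixpoint ones (n : nat) : blocks n :=
  match n return blocks n with
  | 0 => blk 0
  | n'.+1 => bcons 0 (ones n')
  end.

(* F^{(1, ..., 1)} and F^{(n+1)}; transformations between them form the
   deformation complex in degree n+1. *)
Definition Fones n : multifun F n := iterate F (ones n).
Definition Fall n : multifun F n := iterate F (blk n).

(* 1 o phat(f_i, f_{i+1}) o 1 from F(f_n) o ... o F(f_0) to the same composite
   with F(f_{i+1} o f_i) in place of F(f_{i+1}) o F(f_i) *)
Fixpoint pad (n i : nat) : forall (X : C) (m : mids C n.+1) (Y : C)
    (c : chain X m Y), hom (mob (Fones n.+1) c) (mob (Fones n) (ctr i c)) :=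
  match n, i return forall (X : C) (m : mids C n.+1) (Y : C)
    (c : chain X m Y), hom (mob (Fones n.+1) c) (mob (Fones n) (ctr i c)) with
  | 0, _ => fun X m Y c => phat F c.1 c.2
  | n'.+1, 0 => fun X m Y c =>
      (idm (mob (Fones n') c.2.2) \ho phat F c.1 c.2.1) \vo
      idto (esym (comp1A (mob (Fones n') c.2.2) (pfun F c.2.1) (pfun F c.1)))
  | n'.+1, i'.+1 => fun X m Y c => pad i' c.2 \ho idm (pfun F c.1)
  end.

Lemma pad_nat n i X (m : mids C n.+1) Y (c c' : chain X m Y)
    (a : chain2 c c') :
  pad i c' \vo mmor (Fones n.+1) a = mmor (Fones n) (ctr2 i a) \vo pad i c.
Proof.
elim: n i X m c c' a => [|n IH] [|i] X m c c' a.
- exact: (phat_nat F a.1 a.2).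
- exact: (phat_nat F a.1 a.2).
- rewrite [pad 0 c']/= [pad 0 c]/= -vcompA.
  rewrite (arr_idto (esym (comp2A (mmor (Fones n) a.2.2)
    (fmor (pfun F) a.2.1) (fmor (pfun F) a.1))) (esym (comp1A _ _ _))).
  by rewrite !vcompA -!comp2_vcomp phat_nat vcomp1l vcomp1r.
rewrite [pad _ c']/= [pad _ c]/= -!comp2_vcomp vcomp1l vcomp1r.
by congr (_ \ho _); apply: IH.
Qed.

Lemma ones_last2 n X (m : mids C n.+1) Y (c c' : chain X m Y)
    (a : chain2 c c') :
  arr (mmor (Fones n.+1) a) =
  arr (fmor (pfun F) (clast2 a) \ho mmor (Fones n) (cinit2 a)).
Proof.
elim: n X m c c' a => [|n IH] X m c c' a //.
transitivity (arr ((fmor (pfun F) (clast2 a.2) \ho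
  mmor (Fones n) (cinit2 a.2)) \ho fmor (pfun F) a.1)).
  by apply: arr_comp2 => //; apply: IH.
exact: esym (comp2A _ _ _).
Qed.

Lemma ones_last n X (m : mids C n.+1) Y (c : chain X m Y) :
  mob (Fones n.+1) c = pfun F (clast c) \co mob (Fones n) (cinit c).
Proof. exact: arr_src (ones_last2 (id2 c)). Qed.

Section Differential.
Variables (n : nat) (phi : itnat (Fones n) (Fall n)).

(* The three kinds of terms, each with its padding; [idto] only rebrackets
   composites of 1-cells. *)
Definition delta_first X (m : mids C n.+1) Y (c : chain X m Y) :
    hom (mob (Fones n.+1) c) (mob (Fall n.+1) c) :=
  phat F c.1 (compall c.2) \vo (itn phi c.2 \ho idm (pfun F c.1)).

Definition delta_mid (i : nat) X (m : mids C n.+1) Y (c : chain X m Y) :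
    hom (mob (Fones n.+1) c) (mob (Fall n.+1) c) :=
  idto (congr1 (pfun F) (compall_ctr i c)) \vo itn phi (ctr i c) \vo pad i c.

Definition delta_last X (m : mids C n.+1) Y (c : chain X m Y) :
    hom (mob (Fones n.+1) c) (mob (Fall n.+1) c) :=
  idto (congr1 (pfun F) (compall_last c)) \vo
  phat F (compall (cinit c)) (clast c) \vo
  (idm (pfun F (clast c)) \ho itn phi (cinit c)) \vo
  idto (ones_last c).

Definition delta_at X (m : mids C n.+1) Y (c : chain X m Y) :
    hom (mob (Fones n.+1) c) (mob (Fall n.+1) c) :=
  delta_first c
  + \sum_(1 <= i < n.+2) (-1) ^+ i *: delta_mid i.-1 c
  + (-1) ^+ n.+2 *: delta_last c.

Lemma delta_first_nat X (m : mids C n.+1) Y (c c' : chain X m Y)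
    (a : chain2 c c') :
  delta_first c' \vo mmor (Fones n.+1) a = mmor (Fall n.+1) a \vo delta_first c.
Proof.
rewrite /delta_first -vcompA.
transitivity (phat F c'.1 (compall c'.2) \vo
  ((itn phi c'.2 \vo mmor (Fones n) a.2) \ho fmor (pfun F) a.1)).
  by rewrite -[in RHS](vcomp1l (fmor (pfun F) a.1)) comp2_vcomp.
rewrite (itn_nat phi a.2) -[fmor (pfun F) a.1]vcomp1r comp2_vcomp !vcompA.
by congr (_ \vo _); apply: (phat_nat F a.1 (compall2 a.2)).
Qed.

Lemma delta_mid_nat i X (m : mids C n.+1) Y (c c' : chain X m Y)
    (a : chain2 c c') :
  delta_mid i c' \vo mmor (Fones n.+1) a = mmor (Fall n.+1) a \vo delta_mid i c.
Proof.
rewrite /delta_mid -!vcompA pad_nat (vcompA (itn phi _)) (itn_nat phi (ctr2 i a)) !vcompA.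
congr (_ \vo _ \vo _).
exact: arr_idto (arr_fmor (pfun F) (compall2_ctr i a)) _ _.
Qed.

Lemma delta_last_nat X (m : mids C n.+1) Y (c c' : chain X m Y)
    (a : chain2 c c') :
  delta_last c' \vo mmor (Fones n.+1) a = mmor (Fall n.+1) a \vo delta_last c.
Proof.
rewrite /delta_last -!vcompA.
rewrite (arr_idto (ones_last2 a) (ones_last c) (ones_last c')).
rewrite (vcompA (idm _ \ho _)) -comp2_vcomp vcomp1l (itn_nat phi (cinit2 a)).
rewrite -[fmor (pfun F) (clast2 a)]vcomp1r comp2_vcomp !vcompA.
congr (_ \vo _ \vo _).
rewrite -vcompA (phat_nat F (compall2 (cinit2 a)) (clast2 a)) vcompA.
congr (_ \vo _).
exact: arr_idto (arr_fmor (pfun F) (compall2_last a)) _ _.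
Qed.

Lemma delta_nat X (m : mids C n.+1) Y (c c' : chain X m Y) (a : chain2 c c') :
  delta_at c' \vo mmor (Fones n.+1) a = mmor (Fall n.+1) a \vo delta_at c.
Proof.
rewrite /delta_at !vcompDl !vcompDr delta_first_nat.
rewrite vcompZl vcompZr delta_last_nat vcomp_suml vcomp_sumr.
congr (_ + _ + _); apply: eq_bigr => i _.
by rewrite vcompZl vcompZr delta_mid_nat.
Qed.

Definition delta : itnat (Fones n.+1) (Fall n.+1) := ItNat delta_nat.

End Differential.

Lemma delta_lin n : linear (@delta n).
Proof.
move=> x phi psi; apply: itnat_ext => X m Y c.
rewrite /= /delta_at.
have -> : delta_first (x *: phi + psi) c =
    x *: delta_first phi c + delta_first psi c.
  by rewrite /delta_first comp2_linl vcomp_linr.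
have -> : (-1) ^+ n.+2 *: delta_last (x *: phi + psi) c =
    x *: ((-1) ^+ n.+2 *: delta_last phi c) + (-1) ^+ n.+2 *: delta_last psi c.
  rewrite /delta_last comp2_linr vcomp_linr vcomp_linl scalerDr !scalerA.
  by rewrite [x * _]mulrC.
have E i : (-1) ^+ i *: delta_mid (x *: phi + psi) i.-1 c =
    x *: ((-1) ^+ i *: delta_mid phi i.-1 c) +
    (-1) ^+ i *: delta_mid psi i.-1 c.
  rewrite /delta_mid vcomp_linr vcomp_linl scalerDr !scalerA.
  by rewrite [x * _]mulrC.
under eq_bigr do rewrite E.
rewrite big_split /= -scaler_sumr [X in X + _ = _]addrACA [LHS]addrACA.
by rewrite -!scalerDr.
Qed.

Definition defo_mod (n : nat) : lmodType K :=
  match n with 0 => 'rV[K]_0 | n'.+1 => itnat (Fones n') (Fall n') end.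

Definition defo_cobd (n : nat) : defo_mod n -> defo_mod n.+1 :=
  match n return defo_mod n -> defo_mod n.+1 with
  | 0 => fun _ => 0
  | n'.+1 => fun phi => delta phi
  end.

Lemma defo_cobd_lin n : linear (@defo_cobd n).
Proof.
case: n => [|n] x u v; first by rewrite /= scaler0 addr0.
exact: delta_lin.
Qed.

Definition deformation_complex : cochains K := Cochains defo_cobd_lin.

End IterCat.

(* Main.v *)
(* Every composite of cofaces applied to the object of C^0 has a preferred
   isomorphism to F^(n), called [collapse] below, built from phat by composing
   along the cofaces one at a time.  The associativity axiom of F says that the
   coherers are compatible with the collapses; hence so is every canonical
   isomorphism t : w -> w', which is therefore determined by
   collapse w' . t = collapse w.
   The collapse of X'_n = F^(n) is the identity, so alpha_{i,n} is the collapse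
   of a single i-th coface; the collapse of X_n = F^(1,...,1) can be computed in
   any order of bracketing, so beta_{i,n} is the padding by phat at the i-th
   vertex for 0 < i < n, and an identity for i = 0 and i = n. *)
From mathcomp Require Import all_boot all_algebra.
From mathcomp Require Import boolp.
Require Import Defs.

Set Implicit Arguments.
Unset Strict Implicit.
Unset Printing Implicit Defensive.
Import GRing.Theory.
Local Open Scope ring_scope.

(** * Calculus of packaged morphisms, whose end points agree only propositionally *)

Section Arrows.
Variables (K : fieldType) (A : lincat K).

Lemma arr_vcomp (x y z x' y' z' : A) (v : hom y z) (u : hom x y)
    (v' : hom y' z') (u' : hom x' y') :
  arr v = arr v' -> arr u = arr u' -> arr (v \vo u) = arr (v' \vo u').
Proof.
move=> ev eu; have [[ex ey] ez] := (arr_src eu, arr_tgt eu, arr_tgt ev).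
case: x' / ex u' eu => u' eu; case: y' / ey u' v' eu ev => u' v' /arr_inj -> ev.
by case: z' / ez v' ev => v' /arr_inj ->.
Qed.

Lemma arr_idto_tgt (x y : A) (e : x = y) : arr (idto e) = arr (idm y).
Proof. by case: y / e. Qed.

Lemma arr_idtol (x y z : A) (e : y = z) (u : hom x y) :
  arr (idto e \vo u) = arr u.
Proof. by case: z / e; rewrite vcomp1l. Qed.

Lemma arr_idtor (x y z : A) (e : x = y) (u : hom y z) :
  arr (u \vo idto e) = arr u.
Proof. by case: y / e u => u; rewrite vcomp1r. Qed.

(** Discards a left factor that is an identity only up to transport, such as an [idto] or the
    collapse of an inner contraction. *)
Lemma arr_id_l (x y x' y' z : A) (w : hom y z) (u : hom x y) (u' : hom x' y') :
  arr w = arr (idm y') -> arr u = arr u' -> arr (w \vo u) = arr u'.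
Proof. by move=> ew eu; rewrite (arr_vcomp ew eu) vcomp1l. Qed.

Lemma arr_id_r (x y x' y' z : A) (u : hom y z) (w : hom x y) (u' : hom x' y') :
  arr w = arr (idm x') -> arr u = arr u' -> arr (u \vo w) = arr u'.
Proof. by move=> ew eu; rewrite (arr_vcomp eu ew) vcomp1r. Qed.

Lemma arr_idm (x y : A) : x = y -> arr (idm x) = arr (idm y).
Proof. by move->. Qed.

(** The end points are compared by separate hypotheses, since [I] may be empty and then the terms
    give no information on them. *)
Lemma arr_sum (x y x' y' : A) (I : Type) (r : seq I) (a : I -> K)
    (u : I -> hom x y) (v : I -> hom x' y') :
  x = x' -> y = y' -> (forall i, arr (u i) = arr (v i)) ->
  arr (\sum_(i <- r) a i *: u i) = arr (\sum_(i <- r) a i *: v i).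
Proof.
move=> ex ey; case: x' / ex v; case: y' / ey => v uv.
by congr arr; apply: eq_bigr => i _; rewrite (arr_inj (uv i)).
Qed.

(** Having the package of an isomorphism makes [k] left cancellable, although no inverse of [k] is
    given. This is how beta will be solved for. *)
Lemma arr_cancel (x y z x' y' z' : A) (u : isom x y) (b : hom z x)
    (k : hom x' y') (p : hom z' x') :
  arr u = arr k -> arr (u \vo b) = arr (k \vo p) -> arr b = arr p.
Proof.
move=> euk; have [ex ey] := (arr_src euk, arr_tgt euk).
case: x' / ex k p euk => k; case: y' / ey k => k p /arr_inj <- e.
have ez := arr_src e; case: z' / ez p e => p /arr_inj e.
by rewrite -[b]vcomp1l -[p]vcomp1l -(bwdK u) -!vcompA e.
Qed.

End Arrows.

Lemma arr_ni_idtoN (K : fieldType) (A B : lincat K) (P Q : linfunctor A B)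
    (e : P = Q) (x : A) : arr (idtoN e x) = arr (idm (Q x)).
Proof. by case: Q / e. Qed.

Lemma arr_ni_cast (K : fieldType) (A B : lincat K) (P P' Q Q' : linfunctor A B)
    (eP : P = P') (eQ : Q = Q') (t : natiso P Q) (x : A) :
  arr (natiso_cast eP eQ t x) = arr (t x).
Proof. by case: P' / eP; case: Q' / eQ. Qed.

(** * Collapse of a single coface applied to F^(n) *)

Section CollapseFace.
Variables (K : fieldType) (C D : twocat K) (F : pseudofunctor C D).

Lemma arr_itn n (G G' L L' : itercat F n) (s : hom G G') (t : hom L L') :
  arr s = arr t -> forall X (m : mids C n) Y (c : chain X m Y),
  arr (itn s c) = arr (itn t c).
Proof.
move=> e X m Y c.
exact: (f_equal (fun z : {x : itercat F n & {y : itercat F n & hom x y}} =>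
  arr (itn (projT2 (projT2 z)) c)) e).
Qed.

Definition all_iter n : itercat F n := IterOb (ex_intro _ (blk n) erefl).
Definition ones_iter n : itercat F n := IterOb (ex_intro _ (ones n) erefl).

Definition collapse_front n : isom (frontF F n (all_iter n)) (all_iter n.+1) :=
  @mk_isom K C D F n.+1 (frontF F n (all_iter n)) (all_iter n.+1)
    (fun X m Y (c : chain X m Y) => phat F c.1 (compall c.2))
    (fun X m Y c c' a => phat_nat F a.1 (compall2 a.2)).

Lemma collapse_ctr_nat n i X (m : mids C n.+1) Y (c c' : chain X m Y)
    (a : chain2 c c') :
  isom_idto (congr1 (pfun F) (compall_ctr i c')) \vo
    mmor (ctrF F n i (all_iter n)) a =
  mmor (all_iter n.+1) a \vo isom_idto (congr1 (pfun F) (compall_ctr i c)).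
Proof. exact: arr_idto (arr_fmor (pfun F) (compall2_ctr i a)) _ _. Qed.

Definition collapse_ctr n i : isom (ctrF F n i (all_iter n)) (all_iter n.+1) :=
  @mk_isom K C D F n.+1 (ctrF F n i (all_iter n)) (all_iter n.+1) _
    (@collapse_ctr_nat n i).

Definition collapse_last_at n X (m : mids C n.+1) Y (c : chain X m Y) :=
  isom_comp (isom_idto (congr1 (pfun F) (compall_last c)))
    (phat F (compall (cinit c)) (clast c)).

Lemma collapse_last_nat n X (m : mids C n.+1) Y (c c' : chain X m Y)
    (a : chain2 c c') :
  collapse_last_at c' \vo mmor (lastF F n (all_iter n)) a =
  mmor (all_iter n.+1) a \vo collapse_last_at c.
Proof.
rewrite /= -vcompA.
rewrite [X in _ \vo X = _](phat_nat F (compall2 (cinit2 a)) (clast2 a)).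
rewrite !vcompA; congr (_ \vo _).
exact: arr_idto (arr_fmor (pfun F) (compall2_last a)) _ _.
Qed.

Definition collapse_last n : isom (lastF F n (all_iter n)) (all_iter n.+1) :=
  @mk_isom K C D F n.+1 (lastF F n (all_iter n)) (all_iter n.+1) _
    (@collapse_last_nat n).

(** The inner match repeats the test in [iter_face], so that each branch has the required type by
    computation. *)
Definition collapse_face n i :
    isom (iter_face F n i (all_iter n)) (all_iter n.+1) :=
  match i return isom (iter_face F n i (all_iter n)) (all_iter n.+1) with
  | 0 => collapse_front n
  | i'.+1 =>
    match (i' <= n)%N as b return
      isom ((if b then ctrF F n i' else lastF F n) (all_iter n))
        (all_iter n.+1) with
    | true => collapse_ctr n i'
    | false => collapse_last n
    end
  end.

Lemma collapse_frontE n X (m : mids C n.+1) Y (c : chain X m Y) :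
  itn (fwd (collapse_face n 0)) c = phat F c.1 (compall c.2).
Proof. by []. Qed.

Lemma arr_collapse_ctr n i X (m : mids C n.+1) Y (c : chain X m Y) :
  (i <= n)%N ->
  arr (itn (fwd (collapse_face n i.+1)) c) = arr (idm (pfun F (compall c))).
Proof.
rewrite /collapse_face /iter_face.
by case: (i <= n)%N => // _; apply: arr_idto_tgt.
Qed.

Lemma arr_collapse_last n X (m : mids C n.+1) Y (c : chain X m Y) :
  arr (itn (fwd (collapse_face n n.+2)) c) =
  arr (phat F (compall (cinit c)) (clast c)).
Proof. by rewrite /collapse_face /iter_face ltnn; apply: arr_idtol. Qed.

Lemma arr_fmor_ctr n i (H H' : itercat F n) (s : hom H H')
    X (m : mids C n.+1) Y (c : chain X m Y) : (i <= n)%N ->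
  arr (itn (fmor (iter_face F n i.+1) s) c) = arr (itn s (ctr i c)).
Proof. by rewrite /iter_face => ->. Qed.

Lemma arr_fmor_last n (H H' : itercat F n) (s : hom H H')
    X (m : mids C n.+1) Y (c : chain X m Y) :
  arr (itn (fmor (iter_face F n n.+2) s) c) =
  arr (idm (pfun F (clast c)) \ho itn s (cinit c)).
Proof. by rewrite /iter_face ltnn. Qed.

End CollapseFace.

(** * Compatibility of the coherers with the collapses of two successive cofaces *)

Section Coherence.
Variables (K : fieldType) (C D : twocat K) (F : pseudofunctor C D).

Section Coherers.
Variables (n i j : nat) (le_ij : (i <= j)%N) (le_jn : (j <= n.+2)%N).
Variables (H : itercat F n) (X : C) (m : mids C n.+2) (Y : C).
Variable c : chain X m Y.

Let tau := itn (fwd (iter_coherer F le_ij le_jn H)) c.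

Lemma arr_coherer_first : j = 0%N ->
  arr tau = arr (idm (mob H c.2.2) \ho bwd (phat F c.1 c.2.1)).
Proof.
move=> j0; rewrite /tau /iter_coherer; case: (j =P 0%N) => // {}j0.
by rewrite (arr_itn (arr_ni_cast _ _ _ _)); apply: arr_idtol.
Qed.

Lemma arr_coherer_last : i = n.+2 ->
  arr tau =
  arr (phat F (clast (cinit c)) (clast c) \ho idm (mob H (cinit (cinit c)))).
Proof.
move=> ein; rewrite /tau /iter_coherer; case: (j =P 0%N) => [j0|nj0].
  by exfalso; have := le_ij; rewrite ein j0.
case: (i =P n.+2) => // {}ein.
rewrite (arr_itn (arr_ni_cast _ _ _ _)) /=.
by rewrite arr_idtol arr_idtor.
Qed.

Lemma arr_coherer_mid : j <> 0%N -> i <> n.+2 ->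
  arr tau =
  arr (idm (mob (iter_face F n.+1 i (iter_face F n j H)) c)).
Proof.
move=> nj0 nin; rewrite /tau /iter_coherer.
case: (j =P 0%N) => [//|{}nj0]; case: (i =P n.+2) => [//|{}nin].
exact: (arr_itn (arr_ni_idtoN _ _)).
Qed.

End Coherers.

(** The two 1-cells share a middle object that may change under rewriting, so they are transported
    together with it. *)
Lemma arr_phat (X Y Z Y' : C) (f : cell1 C X Y) (g : cell1 C Y Z)
    (f' : cell1 C X Y') (g' : cell1 C Y' Z) :
  existT (fun Y => cell1 C X Y * cell1 C Y Z)%type Y (f, g) =
  existT (fun Y => cell1 C X Y * cell1 C Y Z)%type Y' (f', g') ->
  arr (phat F f g) = arr (phat F f' g').
Proof.
exact: (f_equal (fun z : {Y : C & cell1 C X Y * cell1 C Y Z}%type =>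
  arr (phat F (projT2 z).1 (projT2 z).2))).
Qed.

Lemma compall_pack_last n (X Z Z' Y : C) (m m' : mids C n)
    (c d : chain X m Z) (c' d' : chain X m' Z') (f g : cell1 C Z Y)
    (f' g' : cell1 C Z' Y) (a : chain2 c d) (a' : chain2 c' d')
    (u : hom f g) (u' : hom f' g') :
  pack_last a u = pack_last a' u' ->
  existT (fun Z => cell1 C X Z * cell1 C Z Y)%type Z (compall c, f) =
  existT (fun Z => cell1 C X Z * cell1 C Z Y)%type Z' (compall c', f').
Proof.
pose G (z : {Z : C & ({m : mids C n & {c : chain X m Z &
    {c' : chain X m Z & chain2 c c'}}} *
    {f : cell1 C Z Y & {f' : cell1 C Z Y & hom f f'}})%type}) :=
  existT (fun Z => cell1 C X Z * cell1 C Z Y)%type (projT1 z)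
    (compall (projT1 (projT2 (projT2 z).1)), projT1 (projT2 z).2).
exact: (f_equal G).
Qed.

Lemma arr_phat_last_ctr n i X (m : mids C n.+2) Y (c : chain X m Y) :
  (i <= n)%N ->
  arr (phat F (compall (cinit (ctr i c))) (clast (ctr i c))) =
  arr (phat F (compall (cinit c)) (clast c)).
Proof.
move=> le_in.
rewrite (arr_phat (compall_pack_last (pack_last_ctr (id2 c) le_in))).
by rewrite compall_ctr.
Qed.

Lemma arr_phat_last_ctr_last n X (m : mids C n.+2) Y (c : chain X m Y) :
  arr (phat F (compall (cinit (ctr n.+1 c))) (clast (ctr n.+1 c))) =
  arr (phat F (compall (cinit (cinit c))) (clast c \co clast (cinit c))).
Proof.
exact: (arr_phat (compall_pack_last (pack_last_ctr_last (id2 c)))).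
Qed.

Lemma arr_ho_id (X Y Z : D) (g g' h : cell1 D Y Z) (f f' k : cell1 D X Y)
    (b : hom g g') (a : hom f f') :
  arr b = arr (idm h) -> arr a = arr (idm k) ->
  arr (b \ho a) = arr (idm (h \co k)).
Proof. by move=> eb ea; rewrite (arr_comp2 eb ea) comp2_id. Qed.

(** Associativity of phat makes the factor 1 o phat on the first two 1-cells appear on the right,
    where it cancels against the coherer 1 o phat^-1. What remains is the collapse after contracting
    at the first vertex. *)
Lemma collapse_face_coherer_first n X (m : mids C n.+2) Y (c : chain X m Y)
    le00 le0n :
  arr ((itn (fwd (collapse_face F n.+1 0)) c \vo
        itn (fmor (iter_face F n.+1 0) (collapse_face F n 0)) c) \vo
       itn (fwd (@iter_coherer K C D F n 0 0 le00 le0n (all_iter F n))) c) =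
  arr (itn (fwd (collapse_face F n.+1 1)) c \vo
       itn (fmor (iter_face F n.+1 1) (collapse_face F n 0)) c).
Proof.
rewrite (arr_vcomp (esym (phatA F c.1 c.2.1 (compall c.2.2)))
  (arr_coherer_first le00 le0n (all_iter F n) c erefl)).
rewrite -vcompA -comp2_vcomp vcomp1l fwdK comp2_id vcomp1r.
apply/esym/arr_id_l => //; rewrite (arr_collapse_ctr F c (leq0n _)).
by rewrite /= comp1A.
Qed.

(** Associativity of phat for [r], [g], [l], where [r] composes all 1-cells but the last two; the
    coherer supplies the factor phat o 1. *)
Lemma collapse_face_coherer_last n X (m : mids C n.+2) Y (c : chain X m Y)
    lenn lenn' :
  arr ((itn (fwd (collapse_face F n.+1 n.+2)) c \vo
        itn (fmor (iter_face F n.+1 n.+2) (collapse_face F n n.+2)) c) \vo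
       itn (fwd (@iter_coherer K C D F n n.+2 n.+2 lenn lenn' (all_iter F n)))
         c) =
  arr (itn (fwd (collapse_face F n.+1 n.+3)) c \vo
       itn (fmor (iter_face F n.+1 n.+3) (collapse_face F n n.+2)) c).
Proof.
set r := compall (cinit (cinit c)); set g := clast (cinit c).
set l := clast c.
have E1 : arr (itn (fwd (collapse_face F n.+1 n.+2)) c \vo
      itn (fmor (iter_face F n.+1 n.+2) (collapse_face F n n.+2)) c) =
    arr (phat F r (l \co g)).
  apply: arr_id_l.
    rewrite (arr_collapse_ctr F c (leqnn _)); apply: arr_idm.
    by rewrite -comp1A /l /g /r !compall_last.
  rewrite (arr_fmor_ctr (collapse_face F n n.+2) c (leqnn _)) arr_collapse_last.
  exact: arr_phat_last_ctr_last.
rewrite (arr_vcomp E1 (arr_coherer_last lenn lenn' (all_iter F n) c erefl)).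
rewrite -phatA.
apply/esym/arr_vcomp; first by rewrite arr_collapse_last -compall_last.
rewrite arr_fmor_last; apply: arr_comp2 => //; exact: arr_collapse_last.
Qed.

(** Here the coherer is an identity, so the two orders of collapsing must agree outright. Inner
    contractions collapse by identities, and at most the outer cofaces contribute a phat. *)
Lemma collapse_face_coherer_mid n i j X (m : mids C n.+2) Y (c : chain X m Y) :
  (i <= j)%N -> (j <= n.+2)%N -> j <> 0%N -> i <> n.+2 ->
  arr (itn (fwd (collapse_face F n.+1 i)) c \vo
       itn (fmor (iter_face F n.+1 i) (collapse_face F n j)) c) =
  arr (itn (fwd (collapse_face F n.+1 j.+1)) c \vo
       itn (fmor (iter_face F n.+1 j.+1) (collapse_face F n i)) c).
Proof.
move=> le_ij le_jn nj0 nin.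
case: j nj0 le_ij le_jn => // j _; case: i nin => [|i] nin le_ij le_jn.
  case: (leqP j n) => [le_jn'|lt_nj].
    transitivity (arr (phat F c.1 (compall (ctr j c.2)))).
      apply: arr_id_r; last by rewrite collapse_frontE compall_ctr.
      apply: arr_ho_id; last exact: erefl.
      rewrite (arr_collapse_ctr F c.2 le_jn').
      by rewrite compall_ctr.
    apply/esym/arr_id_l; last by rewrite (arr_fmor_ctr (collapse_face F n 0) c).
    rewrite (arr_collapse_ctr F c) //; apply: arr_idm.
    by rewrite /= compall_ctr.
  (* First coface against last coface: the only case with a phat from each, settled by associativity
     with [r] the composite of the inner 1-cells. *)
  have {lt_nj le_jn} -> : j = n.+1.
    by apply/eqP; rewrite eqn_leq lt_nj -ltnS le_jn.
  set r := compall (cinit c.2); set g := clast c.2.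
  transitivity (arr (phat F c.1 (g \co r) \vo
    (phat F r g \ho idm (pfun F c.1)))).
    apply: arr_vcomp; first by rewrite collapse_frontE compall_last.
    by apply: arr_comp2 => //; apply: arr_collapse_last.
  rewrite -phatA; apply/esym/arr_vcomp; first exact: arr_collapse_last.
  by rewrite arr_fmor_last.
have le_in : (i <= n)%N.
  have : (i <= n.+1)%N := leq_trans le_ij le_jn.
  by rewrite leq_eqVlt => /predU1P[e|//]; case: nin; rewrite e.
have le_in1 : (i <= n.+1)%N := leqW le_in.
case: (leqP j n) => [le_jn'|lt_nj].
  transitivity (arr (idm (pfun F (compall c)))).
    apply: arr_id_l; first exact: arr_collapse_ctr.
    rewrite (arr_fmor_ctr (collapse_face F n j.+1) c le_in1).
    rewrite (arr_collapse_ctr _ _ le_jn').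
    by rewrite compall_ctr.
  apply/esym/arr_id_l; first exact: arr_collapse_ctr.
  rewrite (arr_fmor_ctr (collapse_face F n i.+1) c) //.
  rewrite (arr_collapse_ctr _ _ le_in).
  by rewrite compall_ctr.
(* Inner contraction against last coface: both sides are the phat that attaches the last 1-cell. *)
have {lt_nj le_jn} -> : j = n.+1.
  by apply/eqP; rewrite eqn_leq lt_nj -ltnS le_jn.
transitivity (arr (phat F (compall (cinit c)) (clast c))).
  apply: arr_id_l.
    by rewrite (arr_collapse_ctr F c le_in1) compall_last.
  rewrite (arr_fmor_ctr (collapse_face F n n.+2) c le_in1) arr_collapse_last.
  exact: arr_phat_last_ctr.
apply/esym/arr_id_r; last exact: arr_collapse_last.
rewrite arr_fmor_last; apply: arr_ho_id => //.
by rewrite (arr_collapse_ctr F (cinit c) le_in).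
Qed.

(** The nontrivial coherers sit at [i = j = 0] and [i = j = n.+2]: by the bounds, [j = 0] or
    [i = n.+2] alone already fixes the other index. *)
Lemma collapse_face_coherer n i j (le_ij : (i <= j)%N) (le_jn : (j <= n.+2)%N) :
  fwd (collapse_face F n.+1 i) \vo
    fmor (iter_face F n.+1 i) (collapse_face F n j) \vo
    iter_coherer F le_ij le_jn (all_iter F n) =
  fwd (collapse_face F n.+1 j.+1) \vo
    fmor (iter_face F n.+1 j.+1) (collapse_face F n i).
Proof.
apply: itnat_ext => X m Y c; apply: arr_inj.
have [j0|/eqP nj0] := eqVneq j 0%N.
  have i0 : i = 0%N by move: le_ij; rewrite j0 leqn0 => /eqP.
  subst i j; exact: collapse_face_coherer_first.
have [ein|/eqP nin] := eqVneq i n.+2.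
  have ejn : j = n.+2 by apply/eqP; rewrite eqn_leq le_jn -ein.
  subst i j; exact: collapse_face_coherer_last.
apply: etrans (collapse_face_coherer_mid c le_ij le_jn nj0 nin).
exact: (arr_id_r (arr_coherer_mid le_ij le_jn (all_iter F n) c nj0 nin) erefl).
Qed.

End Coherence.

(** * Collapses of words, and canonical isomorphisms *)

Section Collapse.
Variables (K : fieldType) (C D : twocat K) (F : pseudofunctor C D).
Let S := iter_cosemi F.

(** In the lowest degree the inner coface gives F^(1), which needs no collapse. The three pairs
    (0,0), (1,1), (0,1) have coherers phat^-1, phat and an identity. *)
Lemma collapse_face_coherer0 i j (le_ij : (i <= j)%N) (le_j1 : (j <= 1)%N) :
  fwd (collapse_face F 0 i) \vo iter_coherer0 F le_ij le_j1 tt =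
  collapse_face F 0 j.+1.
Proof.
apply: itnat_ext => X m Y c; apply: arr_inj.
rewrite /iter_coherer0; case: (j =P 0%N) => [j0|nj0].
  have i0 : i = 0%N by move: le_ij; rewrite j0 leqn0 => /eqP.
  subst i j.
  transitivity (arr (phat F c.1 c.2 \vo bwd (phat F c.1 c.2))).
    apply: arr_vcomp => //.
    exact: (arr_itn (arr_ni_cast (tau0_first_src F erefl)
      (tau0_first_tgt F le_ij erefl) (tau0_first F) tt) c).
  by rewrite fwdK arr_collapse_ctr.
have j1 : j = 1%N by case: (j) le_j1 nj0 => [|[]].
case: (i =P 1%N) => [i1|ni1].
  subst i j.
  rewrite arr_collapse_last; apply: arr_id_l; first exact: arr_collapse_ctr.
  exact: (arr_itn (arr_ni_cast (tau0_last_src F le_ij le_j1 erefl)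
    (tau0_last_tgt F erefl) (tau0_last F) tt) c).
have i0 : i = 0%N by case: (i) (leq_trans le_ij le_j1) ni1 => [|[]].
subst i j; rewrite arr_collapse_last.
apply: arr_id_r; first exact: (arr_itn
  (arr_ni_idtoN (iter_face0_comm F le_ij le_j1 nj0 ni1) tt) c).
exact: erefl.
Qed.

(* Indexed by words, not by iterates: distinct words may denote equal iterates
   and yet have distinct collapses. *)
Fixpoint collapse n : forall w : word n.+1,
    @isom K (itercat F n) (faces S w tt) (all_iter F n) :=
  match n return forall w : word n.+1,
    @isom K (itercat F n) (faces S w tt) (all_iter F n) with
  | 0 => fun w => isom_id (all_iter F 0)
  | n'.+1 => fun w =>
      isom_comp (collapse_face F n' w.2)
        (isom_fmor (iter_face F n' w.2) (collapse w.1))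
  end.

(* No elementary isomorphism relates words of length 0. *)
Let compatible n : forall w w' : word n,
    natiso (faces S w) (faces S w') -> Prop :=
  match n return forall w w' : word n,
    natiso (faces S w) (faces S w') -> Prop with
  | 0 => fun _ _ _ => False
  | n'.+1 => fun w w' t => fwd (collapse w') \vo fwd (t tt) = collapse w
  end.

Lemma collapse_elementary n (w w' : word n)
    (t : natiso (faces S w) (faces S w')) :
  elementary t -> compatible t.
Proof.
elim=> {n w w' t} [n w i j le_ij||n w w' t _ IH|n w w' i t _ IH].
- case: n w i j le_ij => [|n] w i j le_ij.
    transitivity (fwd (collapse_face F 0 i) \vo
        fmor (iter_face F 0 i) (idm (all_iter F 0)) \vo
        iter_coherer0 F le_ij (ltn_ord j) tt); first by [].
    rewrite fmor1 vcomp1r collapse_face_coherer0; symmetry.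
    transitivity (fwd (collapse_face F 0 j.+1) \vo
        fmor (iter_face F 0 j.+1) (idm (all_iter F 0))); first by [].
    by rewrite fmor1 vcomp1r.
  pose t := iter_coherer F le_ij (ltn_ord j).
  transitivity (fwd (collapse_face F n.+1 i) \vo fmor (iter_face F n.+1 i)
      (collapse_face F n j \vo fmor (iter_face F n j) (collapse w)) \vo
      t (faces S w tt)); first by [].
  rewrite fmorM -!vcompA.
  (* Naturality moves the coherer past the collapse of the inner word [w], hence to F^(n), where its
     compatibility is known. *)
  rewrite -[fmor _ (fmor _ _) \vo _](ni_nat t (collapse w)).
  rewrite !vcompA collapse_face_coherer -vcompA.
  by rewrite -[RHS]/(fwd (collapse_face F n.+1 j.+1) \vo
    fmor (iter_face F n.+1 j.+1)
      (collapse_face F n i \vo fmor (iter_face F n i) (collapse w))) fmorM.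
- exact: vcomp1l.
- case: n w w' t IH => [|n] w w' t // IH.
  by rewrite /compatible -IH -vcompA fwdK vcomp1r.
case: n w w' i t IH => [|n] w w' i t // IH.
transitivity (fwd (collapse_face F n i) \vo
  fmor (iter_face F n i) (collapse w') \vo
  fmor (iter_face F n i) (t tt)); first by [].
by rewrite -vcompA -fmorM [X in fmor _ X]IH.
Qed.

(** Compatibility passes along a chain of elementary steps. Since [collapse w'] is invertible, it
    pins down the component of [t], whatever chain produced it. *)
Lemma collapse_canonical n (w w' : word n.+1)
    (t : natiso (faces S w) (faces S w')) :
  canonical t -> fwd (collapse w') \vo fwd (t tt) = collapse w.
Proof.
elim=> {w w' t} [w|w w' w'' t s _ IH es]; first exact: vcomp1r.
transitivity (fwd (collapse w'') \vo fwd (s tt) \vo fwd (t tt)).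
  exact: vcompA.
by rewrite [X in X \vo _](collapse_elementary es).
Qed.

End Collapse.

(** * Explicit collapses of the reference objects *)

Section CollapseOnes.
Variables (K : fieldType) (C D : twocat K) (F : pseudofunctor C D).

(** The bracketing that attaches the first 1-cell last, as suits the recursion on strings; [refword]
    brackets from the other end. *)
Fixpoint collapse_ones n : forall X (m : mids C n) Y (c : chain X m Y),
    hom (mob (Fones F n) c) (mob (Fall F n) c) :=
  match n return forall X (m : mids C n) Y (c : chain X m Y),
    hom (mob (Fones F n) c) (mob (Fall F n) c) with
  | 0 => fun X m Y c => idm (pfun F c)
  | n'.+1 => fun X m Y c =>
      phat F c.1 (compall c.2) \vo (collapse_ones c.2 \ho idm (pfun F c.1))
  end.

(** By induction on the tail, one use of associativity of phat exchanges attaching the first and the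
    last 1-cell. *)
Lemma arr_collapse_ones_last n X (m : mids C n.+1) Y (c : chain X m Y) :
  arr (collapse_ones c) =
  arr (phat F (compall (cinit c)) (clast c) \vo
       (idm (pfun F (clast c)) \ho collapse_ones (cinit c))).
Proof.
elim: n X m c => [|n IH] X m c //.
set r := compall (cinit c.2); set g := clast c.2; set f := c.1.
transitivity (arr (phat F f (g \co r) \vo ((phat F r g \vo
    (idm (pfun F g) \ho collapse_ones (cinit c.2))) \ho idm (pfun F f)))).
  apply: arr_vcomp; first by rewrite compall_last.
  by apply: arr_comp2 => //; apply: IH.
rewrite -[X in _ \ho X]vcomp1l comp2_vcomp vcompA.
transitivity (arr ((phat F (r \co f) g \vo (idm (pfun F g) \ho phat F f r)) \vo
  (idm (pfun F g) \ho (collapse_ones (cinit c.2) \ho idm (pfun F f))))).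
  by apply: arr_vcomp; [rewrite phatA | rewrite comp2A].
by rewrite -vcompA -comp2_vcomp vcomp1l.
Qed.

(** Starting the collapse with the phat at any vertex does not change it: associativity of phat at
    the first vertex, induction on the tail at later ones. *)
Lemma arr_collapse_ones_ctr n i X (m : mids C n.+1) Y (c : chain X m Y) :
  arr (collapse_ones (ctr i c) \vo pad F i c) = arr (collapse_ones c).
Proof.
elim: n i X m c => [|n IH] i X m c.
  by rewrite /= comp2_id vcomp1r; case: i => [|i] /=; rewrite vcomp1l.
case: i => [|i].
  rewrite [collapse_ones (ctr 0 c)]/= [pad F 0 c]/= vcompA arr_idtor.
  set f := c.1; set g := c.2.1; set r := compall c.2.2.
  rewrite -vcompA -comp2_vcomp vcomp1l vcomp1r.
  transitivity (arr ((phat F (g \co f) r \vo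
    (idm (pfun F r) \ho phat F f g)) \vo (collapse_ones c.2.2 \ho
    (idm (pfun F g) \ho idm (pfun F f))))).
    by rewrite -vcompA comp2_id -comp2_vcomp vcomp1l vcomp1r.
  rewrite (arr_vcomp (phatA F f g r) (comp2A _ _ _)).
  by rewrite -vcompA -comp2_vcomp vcomp1l.
rewrite [collapse_ones (ctr i.+1 c)]/= [pad F i.+1 c]/=.
rewrite -vcompA -comp2_vcomp vcomp1l.
apply: arr_vcomp; last by apply: arr_comp2 => //; apply: IH.
transitivity (arr (phat F c.1 (compall (ctr i c.2)))) => //.
by rewrite compall_ctr.
Qed.

Lemma arr_collapse_refword n X (m : mids C n) Y (c : chain X m Y) :
  arr (itn (fwd (collapse F (refword n.+1))) c) = arr (collapse_ones c).
Proof.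
elim: n X m Y c => [|n IH] X m Y c //.
rewrite arr_collapse_ones_last.
apply: arr_vcomp; first exact: arr_collapse_last.
rewrite [LHS]arr_fmor_last; apply: arr_comp2 => //; exact: (IH _ _ _ (cinit c)).
Qed.

Lemma arr_collapse_refword' n X (m : mids C n) Y (c : chain X m Y) :
  arr (itn (fwd (collapse F (refword' n.+1))) c) = arr (idm (mob (Fall F n) c)).
Proof.
elim: n X m Y c => [|n IH] X m Y c //.
apply: arr_id_l; first exact: arr_collapse_ctr.
rewrite [LHS](arr_fmor_ctr (collapse F (refword' n.+1)) c (leqnn n)).
rewrite [LHS](IH _ _ _ (ctr n c)).
by rewrite /= compall_ctr.
Qed.

End CollapseOnes.

(** * Comparison of the two coboundaries and of the complexes *)

Section Comparison.
Variables (K : fieldType) (C D : twocat K) (F : pseudofunctor C D).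
Let S := iter_cosemi F.

(** The cofaces append factors at the end while [ones] prepends them; associativity in the target
    2-category reconciles the two. *)
Lemma refob_ones n : refob (star F) n.+1 = ones_iter F n.
Proof.
elim: n => [|n IH]; first exact: iter_ob_eq.
transitivity (lastF F n (ones_iter F n)).
  by rewrite -IH /refob /= /iter_face ltnn.
apply: iter_ob_eq; apply: multifun_ext => X m Y c c' a.
exact: esym (ones_last2 F a).
Qed.

Lemma refob_all n : refob' (star F) n.+1 = all_iter F n.
Proof.
elim: n => [|n IH]; first exact: iter_ob_eq.
transitivity (ctrF F n n (all_iter F n)).
  by rewrite -IH /refob' /= /iter_face leqnn.
apply: iter_ob_eq; apply: multifun_ext => X m Y c c' a.
exact: arr_fmor (compall2_ctr n a).
Qed.

(** In the equation determining the canonical isomorphism, the collapses of both reference words are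
    identities up to transport. *)
Lemma arr_assoc_alpha n (i : 'I_n.+3) X (m : mids C n.+1) Y
    (c : chain X m Y) :
  arr (itn (@assoc_alpha K S (star F) n.+1 i) c) =
  arr (itn (fwd (collapse_face F n i)) c).
Proof.
have e : arr (fwd (collapse F (refword' n.+1))) = arr (idm (all_iter F n)).
  apply: arr_itercat => [|//|X' m' Y' c']; first exact: refob_all.
  exact: arr_collapse_refword'.
have ei : arr (fmor (iter_face F n i) (collapse F (refword' n.+1))) =
    arr (idm (iter_face F n i (all_iter F n))).
  by rewrite (arr_fmor _ e) fmor1.
rewrite -[RHS](arr_id_r (arr_itn ei c) erefl).
have {ei} <- := f_equal (fun s => arr (itn s c))
  (collapse_canonical
    (@tauphiP K S _ ((refword' n.+1, i) : word n.+2) (refword' n.+2))).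
apply/esym/arr_id_l => //.
by rewrite [LHS]arr_collapse_refword' refob_all.
Qed.

Definition isom_at n (G G' : itercat F n) (u : isom G G') X (m : mids C n) Y
    (c : chain X m Y) : isom (mob G c) (mob G' c) :=
  @Isom _ _ (mob G c) (mob G' c) (itn (fwd u) c) (itn (bwd u) c)
    (f_equal (fun s : itnat G G => itn s c) (bwdK u))
    (f_equal (fun s : itnat G' G' => itn s c) (fwdK u)).

(** Beta is the unique solution of an equation with invertible left factor, so it suffices to
    exhibit a solution [p]. *)
Lemma arr_assoc_beta n (i : 'I_n.+3) X (m : mids C n.+1) Y (c : chain X m Y)
    x y z (k : hom x y) (p : hom z x) :
  arr (itn (fwd (@collapse K C D F n.+1 (refword n.+1, i))) c) = arr k ->
  arr (k \vo p) = arr (collapse_ones F c) ->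
  arr (itn (@assoc_beta K S (star F) n.+1 i) c) = arr p.
Proof.
move=> ek kp.
apply: (@arr_cancel _ _ _ _ _ _ _ _ (isom_at (collapse F _) c) _ _ _ ek).
rewrite kp -arr_collapse_refword.
have <- := collapse_canonical (@tauphiP K S _ (refword n.+2)
  ((refword n.+1, i) : word n.+2)).
by [].
Qed.

(** Indexes the terms by cofaces; the coface [k.+1] contracts at the vertex numbered [k]. *)
Definition delta_term n (psi : itnat (Fones F n) (Fall F n)) (i : nat) X
    (m : mids C n.+1) Y (c : chain X m Y) :
    hom (mob (Fones F n.+1) c) (mob (Fall F n.+1) c) :=
  if i is k.+1 then
    if (k <= n)%N then delta_mid psi k c else delta_last psi c
  else delta_first psi c.

Lemma assoc_term n (phi : hom (refob (star F) n.+1) (refob' (star F) n.+1))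
    (psi : itnat (Fones F n) (Fall F n)) (i : 'I_n.+3) X (m : mids C n.+1) Y
    (c : chain X m Y) :
  (forall X (m : mids C n) Y (c : chain X m Y),
    arr (itn phi c) = arr (itn psi c)) ->
  arr (itn (assoc_alpha (star F) i \vo fmor (face S i) phi
    \vo assoc_beta (star F) i) c) =
  arr (delta_term psi i c).
Proof.
move=> e.
transitivity (arr ((itn (assoc_alpha (star F) i) c \vo
  itn (fmor (iter_face F n i) phi) c) \vo itn (assoc_beta (star F) i) c)).
  by [].
case: i => [[|k] lt_i].
(* First coface: [collapse_ones] is by definition the collapse of this word, so beta is an
   identity. *)
- rewrite [RHS]/=; apply: arr_id_r.
    apply: (@arr_assoc_beta n (Ordinal lt_i) X m Y c _ _ _ (collapse_ones F c)
      (idm (mob (Fones F n.+1) c))); last by rewrite vcomp1r.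
    apply: arr_vcomp => //; apply: arr_comp2 => //.
    exact: (arr_collapse_refword F c.2).
  apply: arr_vcomp; first exact: arr_assoc_alpha.
  exact: arr_comp2 (e _ _ _ _) _.
(* For an inner coface alpha is an identity and beta is the padding at vertex [k]. *)
rewrite [nat_of_ord _]/= /delta_term; have [le_kn|lt_nk] := leqP k n.
  rewrite /delta_mid; apply: arr_vcomp.
    rewrite arr_idtol; apply: arr_id_l.
      by rewrite arr_assoc_alpha (arr_collapse_ctr _ _ le_kn) /= compall_ctr.
    by rewrite (arr_fmor_ctr phi c le_kn).
  apply: (@arr_assoc_beta n (Ordinal lt_i) X m Y c _ _ _
    (collapse_ones F (ctr k c)));
    last exact: arr_collapse_ones_ctr.
  apply: arr_id_l.
    by rewrite [LHS](arr_collapse_ctr F c le_kn) /= compall_ctr.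
  rewrite [LHS](arr_fmor_ctr (collapse F (refword n.+1)) c le_kn).
  exact: (arr_collapse_refword F (ctr k c)).
have ek : k = n.+1 by apply/eqP; rewrite eqn_leq lt_nk -2!ltnS lt_i.
move: lt_i {lt_nk}; rewrite {}ek => lt_i.
(* Last coface: beta is again an identity, now because [collapse_ones] may also attach the last
   1-cell last. *)
rewrite /delta_last arr_idtor; apply: arr_id_r.
  apply: (@arr_assoc_beta n (Ordinal lt_i) X m Y c _ _ _
    (phat F (compall (cinit c)) (clast c) \vo
     (idm (pfun F (clast c)) \ho collapse_ones F (cinit c))) (idm _));
    last by rewrite vcomp1r arr_collapse_ones_last.
  apply: arr_vcomp; first exact: arr_collapse_last.
  rewrite [LHS](arr_fmor_last (collapse F (refword n.+1)) c).
  by apply: arr_comp2 => //; apply: (arr_collapse_refword F (cinit c)).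
apply: arr_vcomp.
  by rewrite arr_assoc_alpha arr_collapse_last arr_idtol.
by rewrite (arr_fmor_last phi c); apply: arr_comp2.
Qed.

Lemma delta_atE n (psi : itnat (Fones F n) (Fall F n)) X (m : mids C n.+1) Y
    (c : chain X m Y) :
  delta_at psi c = \sum_(i < n.+3) (-1) ^+ i *: delta_term psi i c.
Proof.
rewrite big_ord_recl big_ord_recr /= expr0 scale1r ltnn addrA /delta_at.
congr (_ + _ + _); rewrite big_add1 big_mkord; apply: eq_bigr => i _.
by rewrite /= /bump /= -ltnS ltn_ord.
Qed.

Lemma arr_assoc_cobd n (phi : hom (refob (star F) n.+1) (refob' (star F) n.+1))
    (psi : itnat (Fones F n) (Fall F n)) :
  (forall X (m : mids C n) Y (c : chain X m Y),
    arr (itn phi c) = arr (itn psi c)) ->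
  forall X (m : mids C n.+1) Y (c : chain X m Y),
  arr (itn (@assoc_cobd K S (star F) n.+1 phi) c) = arr (itn (delta psi) c).
Proof.
move=> e X m Y c.
rewrite [itn (delta psi) c]delta_atE.
pose t (i : 'I_n.+3) := assoc_alpha (star F) i \vo fmor (face S i) phi
    \vo assoc_beta (star F) i.
transitivity (arr (\sum_(i < n.+3) (-1) ^+ i *: itn (t i) c)).
  congr arr.
  (* Evaluation at a string is additive and respects scalars by computation. *)
  exact: (big_morph (fun s :
    itnat (refob (star F) n.+2) (refob' (star F) n.+2) => itn s c)).
apply: arr_sum => [||i]; first by rewrite refob_ones.
  by rewrite refob_all.
exact: assoc_term.
Qed.

(** Common shape of both complexes. With the reference objects as variables, equations between them
    can be eliminated, which removes all transports. *)
Definition iter_cochains_mod (a b : forall n, itercat F n) (n : nat) :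
    lmodType K :=
  match n with 0 => 'rV[K]_0 | n'.+1 => hom (a n') (b n') end.

Definition iter_cochains_cobd (a b : forall n, itercat F n)
    (d : forall n, hom (a n) (b n) -> hom (a n.+1) (b n.+1)) (n : nat) :
    iter_cochains_mod a b n -> iter_cochains_mod a b n.+1 :=
  match n return iter_cochains_mod a b n -> iter_cochains_mod a b n.+1 with
  | 0 => fun _ => 0
  | n'.+1 => d n'
  end.

Lemma iter_cochains_eq (a b a' b' : forall n, itercat F n)
    (d : forall n, hom (a n) (b n) -> hom (a n.+1) (b n.+1))
    (d' : forall n, hom (a' n) (b' n) -> hom (a' n.+1) (b' n.+1))
    (dlin : forall n, linear (@iter_cochains_cobd a b d n))
    (dlin' : forall n, linear (@iter_cochains_cobd a' b' d' n)) :
  (forall n, a n = a' n) -> (forall n, b n = b' n) ->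
  (forall n (phi : hom (a n) (b n)) (psi : hom (a' n) (b' n)),
    (forall X (m : mids C n) Y (c : chain X m Y),
      arr (itn phi c) = arr (itn psi c)) ->
    forall X (m : mids C n.+1) Y (c : chain X m Y),
    arr (itn (d n phi) c) = arr (itn (d' n psi) c)) ->
  Cochains dlin = Cochains dlin'.
Proof.
move=> ea eb.
have {}ea : a = a' by apply: functional_extensionality_dep.
have {}eb : b = b' by apply: functional_extensionality_dep.
case: a' / ea d' dlin'; case: b' / eb => d' dlin' ed.
have edd : d = d'.
  apply: functional_extensionality_dep => n.
  apply: functional_extensionality_dep => phi.
  by apply: itnat_ext => X m Y c; apply: arr_inj; apply: ed.
by case: d' / edd dlin' {ed} => dlin'; congr Cochains; apply: Prop_irrelevance.
Qed.

End Comparison.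

Theorem proposition6p5 (K : fieldType) (C D : twocat K)
    (F : pseudofunctor C D) :
  assoc_complex (star F) = deformation_complex F.
Proof.
(* Both complexes are instances of the common shape by conversion. *)
exact: (@iter_cochains_eq K C D F (fun n => refob (star F) n.+1)
  (fun n => refob' (star F) n.+1) (ones_iter F) (all_iter F)
  (fun n => @assoc_cobd K (iter_cosemi F) (star F) n.+1)
  (fun n => @delta K C D F n) (@assoc_cobd_lin K _ (star F))
  (@defo_cobd_lin K C D F)
  (@refob_ones K C D F) (@refob_all K C D F) (@arr_assoc_cobd K C D F)).
Qed.
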